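(* Let $S_{r,r},S_{c,r},S_{r,c},S_{c,c}$ denote the function $S(\cdot,\cdot)_S$ of the context ($S$ for $N$ even, $S^{\mathrm{odd}}$ for $N$ odd) with each argument on the unit circle (index $r$, real eigenvalues) or in the open unit disk (index $c$, complex eigenvalues). Then for $N$ even or odd, with $e_1=e^{i\theta_1}$, $e_2=e^{i\theta_2}$, $w=r_we^{i\theta_w}$, $z=r_ze^{i\theta_z}$, $$S_{r,r}(e_1,e_2)_S=\frac{\Gamma((N+1)/2)}{2\sqrt\pi\,\Gamma(N/2)}\cos\!\Big(\frac{\theta_2-\theta_1}2\Big)^{N-1},$$ $$S_{c,r}(w,e_1)_S=\Big(\frac{-i}{\sqrt\pi}\Big)^{1/2}\frac1{r_w}\frac{iN}{2^N\sqrt\pi}\sqrt{\frac{\Gamma((N+1)/2)}{\Gamma(N/2+1)}}\left[\int_{\frac{r_w^{-1}-r_w}2}^\infty\frac{dt}{(1+t^2)^{N/2+1}}\right]^{1/2}\left(\frac{e^{-i(\theta_w-\theta_1)/2}}{r_w^{1/2}}+\frac{e^{i(\theta_w-\theta_1)/2}}{r_w^{-1/2}}\right)^{N-1},$$ $$S_{r,c}(e_1,w)_S=\Big(\frac{-i}{\sqrt\pi}\Big)^{1/2}\frac1{r_w}\frac{N(N-1)}{2^{N+2}\sqrt\pi}\left[\int_{\frac{r_w^{-1}-r_w}2}^\infty\frac{dt}{(1+t^2)^{N/2+1}}\right]^{1/2}\sqrt{\frac{\Gamma((N+1)/2)}{\Gamma(N/2+1)}}\left(\frac{e^{-i(\theta_1-\theta_w)/2}}{r_w^{1/2}}+\frac{e^{i(\theta_1-\theta_w)/2}}{r_w^{-1/2}}\right)^{N-2}\left(\frac{e^{-i(\theta_1-\theta_w)/2}}{r_w^{1/2}}-\frac{e^{i(\theta_1-\theta_w)/2}}{r_w^{-1/2}}\right),$$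 $$S_{c,c}(w,z)_S=\frac{N(N-1)}{2^{N+1}\pi r_wr_z}\left[\int_{\frac{r_w^{-1}-r_w}2}^\infty\frac{dt}{(1+t^2)^{N/2+1}}\right]^{1/2}\left[\int_{\frac{r_z^{-1}-r_z}2}^\infty\frac{dt}{(1+t^2)^{N/2+1}}\right]^{1/2}\left(\frac{e^{i(\theta_z-\theta_w)/2}}{(r_wr_z)^{1/2}}+\frac{e^{-i(\theta_z-\theta_w)/2}}{(r_wr_z)^{-1/2}}\right)^{N-2}\left(\frac{e^{i(\theta_z-\theta_w)/2}}{(r_wr_z)^{1/2}}-\frac{e^{-i(\theta_z-\theta_w)/2}}{(r_wr_z)^{-1/2}}\right).$$
   Context: $\mathbb{D}$ is the open unit disk; arguments are taken in $[0,2\pi)$ and $0<r_w,r_z<1$. Put $$\tau(x)=\left(\frac1x\right)^{(N-1)/2}\left[\frac1{\sqrt\pi}\int_{\left||x|^{-1}-|x|\right|/2}^\infty\frac{dt}{(1+t^2)^{N/2+1}}\right]^{1/2},\quad \left(\tfrac1x\right)^{(N-1)/2}:=|x|^{-(N-1)/2}e^{-i(N-1)\arg(x)/2},$$ $r_t:=\frac{2^{N+1}\sqrt\pi}{N-1-4t}\frac{\Gamma(2t+1)\Gamma(N-2t)}{\Gamma(N+1)}$, and for polynomials $q_j$, $$a_j(x)=\begin{cases}|x|^{-1}\tau(x)q_j(x),&x\in\mathbb{D},\\ \sqrt{-i/2}\,\tau(x)q_j(x),&|x|=1,\end{cases}\qquad b_j(x)=\begin{cases}|x|^{-1}\tau(\bar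 x^{-1})q_j(\bar x^{-1}),&x\in\mathbb{D},\\ \sqrt{-i/2}\int_0^{2\pi}\tau(e^{i\theta})q_j(e^{i\theta})\,\mathrm{sgn}(\theta-\arg x)\,d\theta,&|x|=1.\end{cases}$$ $N$ even: $q_{2j}=x^{2j}$, $q_{2j+1}=x^{N-1-2j}$ ($0\le j\le N/2-1$), and $S(x,y)_S=\sum_{l=0}^{N/2-1}\frac1{r_l}[a_{2l}(x)b_{2l+1}(y)-a_{2l+1}(x)b_{2l}(y)]$. $N$ odd: $q_{2j}=x^{2j}$, $q_{2j+1}=x^{N-1-2j}$, $R_j=r_j$ for $0\le2j<(N-1)/2$; $q_{2j}=x^{2j+1}$, $q_{2j+1}=x^{N-2-2j}$, $R_j=r_{j+1/2}$ for $(N-1)/2\le2j<N-1$; and $$q_{N-1}(x)=x^{(N-1)/2}+\sum_{j=0}^{(N-1)/2-1}\frac1{R_j}\Big(\langle q_{2j+1},x^{(N-1)/2}\rangle_S\,q_{2j}(x)-\langle q_{2j},x^{(N-1)/2}\rangle_S\,q_{2j+1}(x)\Big),$$ where $$\langle p,q\rangle_S=-\frac i2\int_0^{2\pi}\!\!d\theta_1\,\tau(e^{i\theta_1})\int_0^{2\pi}\!\!d\theta_2\,\tau(e^{i\theta_2})p(e^{i\theta_1})q(e^{i\theta_2})\,\mathrm{sgn}(\theta_2-\theta_1)+\int_{\mathbb{D}}dw\,\frac{\tau(w)\tau(1/\bar w)}{|w|^2}\Big(p(w)q(1/\bar w)-q(w)p(1/\bar w)\Big).$$ With $\nu_N=\pi\sqrt{\Gamma((N+1)/2)/\Gamma(N/2+1)}$,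 $S^{\mathrm{odd}}(x,y)_S=\sum_{l=0}^{(N-1)/2-1}\frac1{R_l}[a_{2l}(x)b_{2l+1}(y)-a_{2l+1}(x)b_{2l}(y)]+\kappa(x,y)$, where $\kappa(x,y)=\frac{\tau(x)}{\nu_N}q_{N-1}(x)$ if $|y|=1$ and $\kappa(x,y)=0$ if $y\in\mathbb{D}$. These $S$ are the diagonal entries of the $2\times2$ correlation kernel for the eigenvalues of $\mathbf{A}^{-1}\mathbf{B}$ ($\mathbf{A},\mathbf{B}$ independent $N\times N$ real matrices with independent standard Gaussian entries) after the map $z=\frac1i\frac{w-1}{w+1}$, which sends the upper half-plane to $\mathbb{D}$ and the real line to the unit circle.
   Formalization: For N odd two formulas are corrected, as the printed ones fail already at N=1: ν_N is taken as √2·π·√(Γ((N+1)/2)/Γ(N/2+1)), and for x in the disk with |y|=1, κ(x,y)=τ(x)q_{N-1}(x)/(|x|√(-i/2)ν_N). *)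

(* Defs.v *)
From HB Require Import structures.
From mathcomp Require Import all_boot all_order all_algebra.
From mathcomp Require Import all_classical all_reals all_analysis.
From mathcomp Require Import complex.

Set Implicit Arguments.
Unset Strict Implicit.
Unset Printing Implicit Defensive.

Import Order.TTheory GRing.Theory Num.Theory.
Import numFieldNormedType.Exports.
Local Open Scope classical_set_scope.
Local Open Scope ring_scope.
Local Open Scope complex_scope.

(* Complex roots are taken with [sqrtc], the principal branch (nonnegative real
   part, sqrtc (-1) = 'i).  Arguments lie in [0, 2 pi), and the half-angle
   phases below depend on this choice.  The kernel is only meant to be evaluated
   on the closed unit disk, so "x in the open disk" is [normc x < 1] and the
   remaining branch stands for |x| = 1. *)

Notation normc := Normc.normc.

Definition cis {R : realType} (t : R) : R[i] := (cos t) +i* (sin t).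

Definition argc {R : realType} (x : R[i]) : R :=
  xget 0 [set t | 0 <= t < 2 * pi /\ x = (normc x)%:C * cis t].

Definition Gamma {R : realType} (s : R) : R :=
  \int[@lebesgue_measure R]_(t in `]0, +oo[) (t `^ (s - 1) * expR (- t)).

Definition Cintegral {d} {T : measurableType d} {R : realType}
    (mu : {measure set T -> \bar R}) (D : set T) (f : T -> R[i]) : R[i] :=
  (\int[mu]_(t in D) complex.Re (f t)) +i* (\int[mu]_(t in D) complex.Im (f t)).

Definition circle_integral {R : realType} (f : R -> R[i]) : R[i] :=
  Cintegral (@lebesgue_measure R) `[0, 2 * pi] f.

(* dw = du dv for w = u + iv. *)
Definition disk_integral {R : realType} (f : R[i] -> R[i]) : R[i] :=
  Cintegral (@lebesgue_measure R \x @lebesgue_measure R)%E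
    [set p : R * R | normc (p.1 +i* p.2) < 1] (fun p => f (p.1 +i* p.2)).

Definition tail {R : realType} (N : nat) (s : R) : R :=
  \int[@lebesgue_measure R]_(t in `[s, +oo[)
     ((1 + t ^+ 2) `^ (N%:R / 2 + 1))^-1.

Definition tau {R : realType} (N : nat) (x : R[i]) : R[i] :=
  ((normc x) `^ (- ((N%:R - 1) / 2)))%:C
  * cis (- ((N%:R - 1) * argc x / 2))
  * (Num.sqrt ((Num.sqrt pi)^-1 * tail N (`|(normc x)^-1 - normc x| / 2)))%:C.

Definition rnorm {R : realType} (N : nat) (t : R) : R :=
  2 ^+ N.+1 * Num.sqrt pi / (N%:R - 1 - 4 * t)
  * (Gamma (2 * t + 1) * Gamma (N%:R - 2 * t) / Gamma (N%:R + 1)).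

Definition acoef {R : realType} (N : nat) (q : {poly R[i]}) (x : R[i]) : R[i] :=
  if normc x < 1 then ((normc x)^-1)%:C * tau N x * q.[x]
  else sqrtc (- 'i%C / 2) * tau N x * q.[x].

Definition bcoef {R : realType} (N : nat) (q : {poly R[i]}) (x : R[i]) : R[i] :=
  if normc x < 1 then
    ((normc x)^-1)%:C * tau N (conjc x)^-1 * q.[(conjc x)^-1]
  else
    sqrtc (- 'i%C / 2) *
    circle_integral (fun t =>
      tau N (cis t) * q.[cis t] * (Num.sg (t - argc x))%:C).

Definition skew_prod {R : realType} (N : nat) (p q : {poly R[i]}) : R[i] :=
  - ('i%C / 2) *
    circle_integral (fun t1 => tau N (cis t1) *
      circle_integral (fun t2 =>
        tau N (cis t2) * p.[cis t1] * q.[cis t2] * (Num.sg (t2 - t1))%:C))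
  + disk_integral (fun w =>
      tau N w * tau N (conjc w)^-1 / ((normc w) ^+ 2)%:C
      * (p.[w] * q.[(conjc w)^-1] - q.[w] * p.[(conjc w)^-1])).

Definition q_even {R : realType} (N k : nat) : {poly R[i]} :=
  if odd k then 'X^(N - 1 - 2 * k./2) else 'X^(2 * k./2).

Definition S_even {R : realType} (N : nat) (x y : R[i]) : R[i] :=
  \sum_(l < N./2) ((rnorm N (l%:R : R))^-1)%:C *
    (acoef N (q_even N (2 * l)) x * bcoef N (q_even N (2 * l + 1)) y
     - acoef N (q_even N (2 * l + 1)) x * bcoef N (q_even N (2 * l)) y).

(* [q_odd N k] is q_k for k < N - 1; q_{N-1} is [q_odd_last N]. *)
Definition q_odd {R : realType} (N k : nat) : {poly R[i]} :=
  let j := k./2 in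
  if (2 * j < (N - 1)./2)%N
  then (if odd k then 'X^(N - 1 - 2 * j) else 'X^(2 * j))
  else (if odd k then 'X^(N - 2 - 2 * j) else 'X^(2 * j + 1)).

Definition R_odd {R : realType} (N j : nat) : R :=
  if (2 * j < (N - 1)./2)%N then rnorm N (j%:R) else rnorm N (j%:R + 1 / 2).

Definition q_odd_last {R : realType} (N : nat) : {poly R[i]} :=
  let h : {poly R[i]} := 'X^((N - 1)./2) in
  h + \sum_(j < (N - 1)./2) ((R_odd N j : R)^-1)%:C *:
        (skew_prod N (q_odd N (2 * j + 1)) h *: q_odd N (2 * j)
         - skew_prod N (q_odd N (2 * j)) h *: q_odd N (2 * j + 1)).

(* nu_N is the integral of tau(e^{i t}) q_{N-1}(e^{i t}) over [0, 2 pi].  Its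
   value carries the factor sqrt 2: only the x^((N-1)/2) term of q_{N-1}
   contributes, and tau(e^{i t}) e^{i (N-1) t / 2} is the constant
   sqrt (Gamma ((N+1)/2) / (2 Gamma (N/2 + 1))). *)
Definition nu {R : realType} (N : nat) : R :=
  Num.sqrt 2 * pi * Num.sqrt (Gamma ((N%:R + 1) / 2) / Gamma (N%:R / 2 + 1)).

(* For |x| = 1 this is tau(x) q_{N-1}(x) / nu_N.  For x in the open disk the
   weight of tau(x) in [acoef] changes from sqrt(-i/2) to 1/|x|, and the value is
   tau(x) q_{N-1}(x) / (|x| sqrt(-i/2) nu_N).  The shorter expression
   tau(x) q_{N-1}(x) / nu_N on the disk makes the closed form of the (disk, circle)
   entry fail, already for N = 1. *)
Definition kappa {R : realType} (N : nat) (x y : R[i]) : R[i] :=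
  if normc y < 1 then 0
  else acoef N (q_odd_last N) x / (sqrtc (- 'i%C / 2) * (nu N)%:C).

Definition S_odd {R : realType} (N : nat) (x y : R[i]) : R[i] :=
  \sum_(l < (N - 1)./2) ((R_odd N l : R)^-1)%:C *
    (acoef N (q_odd N (2 * l)) x * bcoef N (q_odd N (2 * l + 1)) y
     - acoef N (q_odd N (2 * l + 1)) x * bcoef N (q_odd N (2 * l)) y)
  + kappa N x y.

Definition S_kernel {R : realType} (N : nat) (x y : R[i]) : R[i] :=
  if odd N then S_odd N x y else S_even N x y.

(* Main.v *)
(* Write N = M + 1 and give x = r e^{i t} the square root y = sqrt(r) e^{i t/2}.
   Then tau(x) x^k = T(r) y^k y^{-(M-k)}, a product which is multiplicative in y,
   and 1 / r_{k/2} = (M - 2k) D C(M, k) with D = N / (2^{N+1} sqrt pi).  The pairs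
   of exponents (k, M - k) occurring in S exhaust {0, ..., M} (up to k = M/2, whose
   coefficient vanishes), so S is a sum over all k of (M - 2k) D C(M, k) a_k b_{M-k}.
   For y in the disk it is a derivative of the binomial formula; for y on the circle
   the integral of e^{i m t} sgn(t - phi) with m = (M - 2k)/2 cancels the factor M - 2k.

   For N odd that integral has an extra constant term, which kappa compensates:
   the disk part of <x^k, x^{M/2}> vanishes because its integrand gets multiplied by a
   nontrivial phase under rotations, so that q_{N-1} is a multiple of (1 + x)^M.
   The constants follow from (N+2) tail_{N+2}(0) = (N+1) tail_N(0),
   Gamma(s+1) = s Gamma(s) and Gamma(1/2) = sqrt pi. *)

Require Import Defs.
From HB Require Import structures.
From mathcomp Require Import all_boot all_order all_algebra.
From mathcomp Require Import all_classical all_reals all_analysis.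
From mathcomp Require Import measurable_realfun complex ring lra zify.

Set Implicit Arguments.
Unset Strict Implicit.
Unset Printing Implicit Defensive.

Import Order.TTheory GRing.Theory Num.Theory.
Import numFieldNormedType.Exports.
Local Open Scope classical_set_scope.
Local Open Scope ring_scope.
Local Open Scope complex_scope.

(** * An improper integration by parts formula *)

(** The integrals in the definitions are [fine] parts of extended-real integrals, and this shapes
    the analysis. The Gamma and tail recurrences are first proved between integrals of nonnegative
    functions in the extended reals, where an infinite value is allowed; they pass to [fine]
    afterwards, which gives 0 on both sides in the infinite case. On the disk the integrand contains
    [argc] through [tau], so the rotation argument keeps to operations that make sense for an
    arbitrary integrand: composition with a measure preserving map, and negation. Hence the phase is
    chosen to be ['i]: it exchanges real and imaginary parts up to sign, so no integral of a sum has
    to be split. The phase -1 would do this too, but for |k - h| = 1 it demands a rotation by pi,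
    where the factorization into shears has the pole tan(pi/2). Since [argc] jumps, [tau] itself
    does not change by a fixed phase under rotation; the product of its values at w and at 1 / conj
    w does. The tail at 0 is needed in two forms: a Gamma quotient for [nu] and the entries with an
    argument on the circle, and a central binomial coefficient for the multiple of (1 + x)^M. *)

Lemma ge0_FTC_oy (R : realType) (f g F : R -> R) (a A B : R) :
  (forall x, a < x -> 0 <= f x) -> (forall x, a < x -> 0 <= g x) ->
  (forall x, a < x -> {for x, continuous f}) ->
  (forall x, a < x -> {for x, continuous g}) ->
  (forall x, a < x -> is_derive x 1 F (f x - g x)) ->
  F x @[x --> a^'+] --> A -> F x @[x --> +oo] --> B ->
  (\int[@lebesgue_measure R]_(x in `]a, +oo[) (f x)%:E + A%:E =
   \int[@lebesgue_measure R]_(x in `]a, +oo[) (g x)%:E + B%:E)%E.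
Proof.
move=> f0 g0 cf cg dF FA FB.
(* With [n.+2] instead of [n.+1], [u n < v n] holds already at n = 0, so every [K n] is a
   nondegenerate segment. *)
pose u (n : nat) : R := a + n.+2%:R^-1.
pose v (n : nat) : R := a + n.+1%:R.
have au n : a < u n by rewrite ltrDl invr_gt0 ltr0n.
have uv n : u n < v n.
  rewrite ltrD2l (lt_le_trans (y := 1))//; last by rewrite ler1n.
  by rewrite invf_lt1 ?ltr0n// ltr1n.
pose K n := `[u n, v n]%classic.
have KE : `]a, +oo[%classic = \bigcup_n K n.
  apply/seteqP; split => [x /=|x [n _]].
    rewrite in_itv/= andbT => ax.
    have xa : 0 < x - a by rewrite subr_gt0.
    pose n := maxn (Num.truncn (x - a)^-1) (Num.truncn (x - a)).
    exists n => //; rewrite /K /= in_itv/=; apply/andP; split.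
      rewrite /u -lerBrDl -[leRHS]invrK lef_pV2 ?posrE ?ltr0n ?invr_gt0//.
      have [_ /ltW h] := andP (truncn_itv (ltW (eq_ind_r _ xa (invr_gt0 _)))).
      apply: (le_trans h); rewrite ler_nat ltnS; apply: leqW.
      exact: leq_maxl.
    rewrite /v -lerBlDl.
    have [_ /ltW h] := andP (truncn_itv (ltW xa)).
    apply: (le_trans h); rewrite ler_nat ltnS.
    exact: leq_maxr.
  rewrite /K /= !in_itv/= andbT => /andP[+ _]; exact: lt_le_trans (au n).
have ndK : nondecreasing_seq K.
  move=> m n mn; rewrite subsetEset => x; rewrite /K /= !in_itv/= => /andP[h1 h2].
  apply/andP; split; [apply: le_trans h1 | apply: (le_trans h2)].
    by rewrite lerD2l lef_pV2 ?posrE ?ltr0n// ler_nat !ltnS.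
  by rewrite lerD2l ler_nat ltnS.
have inK n x : K n x -> a < x.
  rewrite /K /= in_itv/= => /andP[+ _]; exact: lt_le_trans (au n).
have wK (k : R -> R) : (forall x, a < x -> {for x, continuous k}) ->
    forall n, {within K n, continuous k}.
  move=> ck n; apply: continuous_in_subspaceT => x /set_mem /inK; exact: ck.
have iK (k : R -> R) : (forall x, a < x -> {for x, continuous k}) ->
    forall n, (@lebesgue_measure R).-integrable (K n) (EFin \o k).
  move=> ck n; apply: continuous_compact_integrable; first exact: segment_compact.
  exact: wK.
have cvgK (k : R -> R) : (forall x, a < x -> 0 <= k x) ->
    (forall x, a < x -> {for x, continuous k}) ->
    (\int[@lebesgue_measure R]_(x in K i) (k x)%:E)%E @[i --> \oo] -->
    (\int[@lebesgue_measure R]_(x in `]a, +oo[) (k x)%:E)%E.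
  move=> k0 ck; rewrite KE; apply: ge0_nondecreasing_set_cvg_integral => //.
  - by move=> n; exact: measurable_itv.
  - by move=> n; exact: measurable_int (iK _ ck n).
  - by move=> n x /inK ax; rewrite lee_fin k0.
have step n : (\int[@lebesgue_measure R]_(x in K n) (f x)%:E =
    \int[@lebesgue_measure R]_(x in K n) (g x)%:E + (F (v n) - F (u n))%:E)%E.
  have cF x : a < x -> {for x, continuous F}.
    move=> /dF d; apply: differentiable_continuous; apply/derivable1_diffP.
    exact: ex_derive.
  have := @continuous_FTC2 R (f \- g) F _ _ (uv n).
  have -> : (\int[lebesgue_measure]_(x in K n) ((f \- g) x)%:E =
      \int[lebesgue_measure]_(x in K n) (f x)%:E -
      \int[lebesgue_measure]_(x in K n) (g x)%:E)%E.
    by rewrite -integralB_EFin//; [exact: measurable_itv|exact: iK|exact: iK].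
  rewrite EFinB => <-.
  - by rewrite addeC subeK// integrable_fin_num//; [exact: measurable_itv|exact: iK].
  - apply: (wK (f \- g)) => x ax; apply: continuousB; [exact: cf|exact: cg].
  - split.
    + move=> x; rewrite in_itv/= => /andP[ux _].
      by have := dF x (lt_trans (au n) ux) => d; exact: ex_derive.
    + by apply: cvg_at_right_filter; apply: cF.
    + by apply: cvg_at_left_filter; apply: cF; exact: lt_trans (au n) (uv n).
  - move=> x; rewrite in_itv/= => /andP[ux _].
    by have := dF x (lt_trans (au n) ux) => d; rewrite derive1E derive_val.
have cvu : F (u n) @[n --> \oo] --> A.
  have /cvg_at_rightP : F x @[x --> a^'+] --> A by [].
  apply; split => //.
  rewrite -[X in _ --> X]addr0; apply: cvgD; first exact: cvg_cst.
  have := @cvg_harmonic R; rewrite -cvg_shiftS; apply: cvg_trans.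
  by apply: near_eq_cvg; near=> n.
have cvv : F (v n) @[n --> \oo] --> B.
  move/cvg_pinftyP : FB; apply.
  apply/cvgryPge => r; near=> n.
  rewrite /v -lerBlDl; apply: (@le_trans _ _ n%:R); last by rewrite ler_nat.
  by near: n; exact: nbhs_infty_ger.
have cvd : (F (v n) - F (u n))%:E @[n --> \oo] --> (B - A)%:E.
  by apply: cvg_EFin; [exact: nearW|exact: cvgB].
have c1 := cvgK f f0 cf.
have c2 := cvgeD (fin_num_adde_defl _ (isT : (B - A)%:E \is a fin_num))
  (cvgK g g0 cg) cvd.
rewrite (funext step) in c1.
rewrite (cvg_unique (@ereal_hausdorff R) c1 (c2 _)).
by rewrite -addeA -EFinD subrK.
Unshelve. all: by end_near. Qed.

Corollary ge0_FTC_oy0 (R : realType) (f F : R -> R) (a A B : R) :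
  (forall x, a < x -> 0 <= f x) ->
  (forall x, a < x -> {for x, continuous f}) ->
  (forall x, a < x -> is_derive x 1 F (f x)) ->
  F x @[x --> a^'+] --> A -> F x @[x --> +oo] --> B ->
  (\int[@lebesgue_measure R]_(x in `]a, +oo[) (f x)%:E = (B - A)%:E)%E.
Proof.
move=> f0 cf dF FA FB.
have E : (\int[@lebesgue_measure R]_(x in `]a, +oo[) (f x)%:E + A%:E =
    \int[@lebesgue_measure R]_(x in `]a, +oo[) (0 : R)%:E + B%:E)%E.
  apply: (ge0_FTC_oy (F := F)) => //.
  - by move=> x _; exact: cst_continuous.
  - by move=> x ax; rewrite subr0; exact: dF.
by move: E; rewrite integral0 add0e EFinB => <-; rewrite addeK.
Qed.

(** * The Gamma function at half-integers *)

Lemma cvgr_expR_powR (R : realType) (s : R) : 0 < s ->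
  t `^ s * expR (- t) @[t --> +oo] --> (0 : R).
Proof.
move=> s0; apply/cvgrPdist_le => e e0; near=> t.
have t0 : 0 < t by near: t; exact: nbhs_pinfty_gt.
rewrite sub0r normrN ger0_norm ?mulr_ge0 ?powR_ge0 ?expR_ge0//.
(* t^s exp(-t) is the s-th power of t exp(-t/s), so it suffices to bring this base below e^(1/s).
   Squaring exp(t/(2s)) >= t/(2s) bounds the base by 4 s^2 / t. *)
have -> : expR (- t) = expR (- (t / s)) `^ s by rewrite -expRM mulNr divfK ?gt_eqF.
rewrite -powRM ?ltW ?expR_gt0//.
have -> : e = (e `^ s^-1) `^ s by rewrite -powRrM mulVf ?gt_eqF// powRr1// ltW.
apply: (@gt0_ltr_powR _ s s0); rewrite ?nnegrE ?powR_ge0//.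
  by rewrite mulr_ge0 ?expR_ge0 ?ltW.
have h : expR (- (t / s)) <= 4 * s ^+ 2 / t ^+ 2.
  have -> : 4 * s ^+ 2 / t ^+ 2 = ((t / (2 * s)) ^+ 2)^-1.
    by field; rewrite !gt_eqF.
  rewrite expRN lef_pV2 ?posrE ?expR_gt0 ?exprn_gt0 ?divr_gt0 ?mulr_gt0//.
  have -> : t / s = (t / (2 * s)) + (t / (2 * s)) by field; rewrite gt_eqF.
  rewrite expRD -expr2 lerXn2r ?nnegrE ?expR_ge0 ?divr_ge0 ?mulr_ge0 ?ltW//.
  by apply: lt_le_trans (expR_ge1Dx _); rewrite ltrDr.
apply: (@le_lt_trans _ _ (4 * s ^+ 2 / t)).
  have -> : 4 * s ^+ 2 / t = t * (4 * s ^+ 2 / t ^+ 2) by field; rewrite gt_eqF.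
  by rewrite ler_pM2l.
rewrite ltr_pdivrMr// [X in _ < X]mulrC -ltr_pdivrMr ?powR_gt0//.
by near: t; apply: nbhs_pinfty_gt; exact: num_real.
Unshelve. all: by end_near. Qed.

Lemma is_derive_expRN (R : realType) (x : R) :
  is_derive x 1 (fun t => expR (- t)) (- expR (- x)).
Proof.
by apply: is_derive_eq; rewrite /GRing.scale /= mulrC mulN1r.
Qed.

Lemma is_derive_continuous (R : realType) (F : R -> R) (x d : R) :
  is_derive x 1 F d -> {for x, continuous F}.
Proof.
move=> h; apply: differentiable_continuous; apply/derivable1_diffP.
exact: ex_derive.
Qed.

Lemma continuous_Gamma_integrand (R : realType) (p x : R) : 0 < x ->
  {for x, continuous (fun t : R => t `^ p * expR (- t))}.
Proof.
move=> x0; apply: continuousM.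
  exact: is_derive_continuous (is_derive1_powR p x0).
exact: is_derive_continuous (is_derive_expRN x).
Qed.

Lemma GammaD1 (R : realType) (s : R) : 0 < s -> Gamma (s + 1) = s * Gamma s.
Proof.
move=> s0.
pose f t : R := t `^ (s + 1 - 1) * expR (- t).
pose k t : R := t `^ (s - 1) * expR (- t).
have k0 x : 0 < x -> 0 <= k x by rewrite mulr_ge0 ?powR_ge0 ?expR_ge0.
have h : (\int[lebesgue_measure]_(x in `]0%R, +oo[) (f x)%:E + 0%:E =
    \int[lebesgue_measure]_(x in `]0%R, +oo[) (s * k x)%:E + 0%:E)%E.
  apply: (ge0_FTC_oy (F := fun t => - (t `^ s * expR (- t)))).
  - by move=> x x0; rewrite mulr_ge0 ?powR_ge0 ?expR_ge0.
  - by move=> x x0; rewrite mulr_ge0 ?k0 ?ltW.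
  - by move=> x x0; exact: continuous_Gamma_integrand.
  - move=> x x0; apply: continuousM; first exact: cst_continuous.
    exact: continuous_Gamma_integrand.
  - move=> x x0; have d1 := is_derive1_powR s x0; have d2 := is_derive_expRN x.
    apply: is_derive_eq; rewrite /GRing.scale /= /f /k addrK; ring.
  - rewrite -[X in _ --> X]oppr0; apply: cvgN.
    rewrite -[X in _ --> X](mul0r (expR (- 0))); apply: cvgM.
      exact: powR_cvg0.
    apply: cvg_at_right_filter.
    exact: is_derive_continuous (is_derive_expRN _).
  - by rewrite -[X in _ --> X]oppr0; apply: cvgN; exact: cvgr_expR_powR.
move: h; rewrite !adde0 => h.
have hk : (\int[lebesgue_measure]_(x in `]0%R, +oo[) (s * k x)%:E =
    s%:E * \int[lebesgue_measure]_(x in `]0%R, +oo[) (k x)%:E)%E.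
  rewrite -ge0_integralZl_EFin//.
  - by move=> x; rewrite /= in_itv/= andbT lee_fin; exact: k0.
  - apply/measurable_EFinP; apply: open_continuous_measurable_fun => //.
    move=> x /set_mem; rewrite /= in_itv/= andbT => x0.
    exact: continuous_Gamma_integrand.
  - exact: ltW.
(* As s > 0, the integrals for s + 1 and s are finite or infinite together, and [fine] sends
   infinite values to 0. *)
rewrite /Gamma /Rintegral h hk -/k; case: (\int[_]_(x in _) _)%E => [r| |] //=.
  by rewrite gt0_muley ?lte_fin// mulr0.
by rewrite gt0_muleNy ?lte_fin// mulr0.
Qed.

Lemma Gamma_1 (R : realType) : Gamma 1 = 1 :> R.
Proof.
have E : (\int[lebesgue_measure]_(t in `]0%R, +oo[)
    (t `^ (1 - 1) * expR (- t))%:E = (0 - (-1) : R)%:E)%E.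
  apply: (@ge0_FTC_oy0 R (fun t => t `^ (1 - 1) * expR (- t))
    (fun t => - expR (- t)) 0 (-1) 0).
- by move=> x x0; rewrite mulr_ge0 ?powR_ge0 ?expR_ge0.
- by move=> x x0; exact: continuous_Gamma_integrand.
- move=> x x0; have d2 := is_derive_expRN x; apply: is_derive_eq.
  by rewrite subrr powRr0 mul1r opprK.
- apply: cvgN; rewrite -(expR0 R) -[in X in _ --> X]oppr0.
  by apply: cvg_at_right_filter; exact: is_derive_continuous (is_derive_expRN _).
- by rewrite -[X in _ --> X]oppr0; apply: cvgN; exact: cvgr_expR.
by rewrite /Gamma /Rintegral E /= sub0r opprK.
Qed.

Lemma Gamma_fact (R : realType) (n : nat) : Gamma (n%:R + 1) = n`!%:R :> R.
Proof.
elim: n => [|n IH]; first by rewrite add0r Gamma_1.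
by rewrite GammaD1 ?ltr0n// -natr1 IH factS natrM natr1.
Qed.

Lemma Gamma_half (R : realType) : Gamma (1 / 2) = Num.sqrt pi :> R.
Proof.
pose P := @gauss_integral_proof.integral0_gauss R.
have icg (u : R) : (@lebesgue_measure R).-integrable `[0, u] (EFin \o gauss_fun).
  apply: continuous_compact_integrable; first exact: segment_compact.
  by apply: continuous_subspaceT; exact: continuous_gauss_fun.
have dP (x : R) : 0 < x -> is_derive x 1 P (gauss_fun x).
  move=> x0.
  have [] := @continuous_FTC1 R gauss_fun (BLeft 0) x (x + 1) _ (icg _).
  - by rewrite ltrDl.
  - by rewrite /=; rewrite lte_fin.
  - by exact: continuous_gauss_fun.
  by rewrite derive1E => d1 <-; exact: derivableP.
have P0 (x : R) : 0 <= P x by exact: gauss_integral_proof.integral0_gauss_ge0.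
have Py : P x @[x --> +oo] --> Num.sqrt pi / 2.
  (* The known Gaussian limit is that of [P x ^+ 2], namely pi / 4; since [P] is nonnegative, a
     square root recovers the limit of [P]. *)
  have : Num.sqrt (P x ^+ 2) @[x --> +oo] --> Num.sqrt (pi / 4).
    apply: continuous_cvg => //;
      [exact: sqrt_continuous|exact: gauss_integral_proof.cvg_integral0_gauss_sqr].
  rewrite sqrtrM ?pi_ge0// sqrtrV// (_ : 4 = 2 ^+ 2) ?sqrtr_sqr ?ger0_norm//;
    last by ring.
  rewrite (_ : (fun _ => Num.sqrt _) = P)//.
  by apply/funext => r; rewrite sqrtr_sqr ger0_norm.
have Pr : P x @[x --> 0^'+] --> 0.
  have : {within `[0, 1], continuous P}.
    exact: (@parameterized_integral_continuous R 0 1).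
  move=> /continuous_within_itvP -/(_ ltr01) [_ + _].
  by rewrite /P /gauss_integral_proof.integral0_gauss set_itv1 Rintegral_set1.
have sqy : Num.sqrt x @[x --> +oo] --> (+oo : set_system R).
  apply/cvgryPge => r; near=> x.
  have x0 : 0 <= x by near: x; exact: nbhs_pinfty_ge.
  apply: le_trans (ler_norm r) _; rewrite -sqrtr_sqr ler_sqrt//.
have sq0 : Num.sqrt x @[x --> (0:R)^'+] --> (0:R)^'+.
  move=> S [e /= e0 Se]; exists (e ^+ 2); first by rewrite /= exprn_gt0.
  move=> x /=; rewrite sub0r normrN => xe x0; apply: Se; last by rewrite /= sqrtr_gt0.
  rewrite /= sub0r normrN ger0_norm ?sqrtr_ge0// -(gtr0_norm e0) -sqrtr_sqr.
  by rewrite ltr_sqrt ?exprn_gt0// (le_lt_trans (ler_norm _)).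
have E : (\int[lebesgue_measure]_(t in `]0%R, +oo[)
    (t `^ (1 / 2 - 1) * expR (- t))%:E = (Num.sqrt pi - 0 : R)%:E)%E.
  (* The substitution t = u^2, carried out on primitives: 2 P(sqrt t) has derivative t^(-1/2)
     exp(-t). *)
  apply: (@ge0_FTC_oy0 R (fun t => t `^ (1 / 2 - 1) * expR (- t))
    (fun t => 2 * P (Num.sqrt t)) 0 0 (Num.sqrt pi)).
- by move=> x x0; rewrite mulr_ge0 ?powR_ge0 ?expR_ge0.
- by move=> x x0; exact: continuous_Gamma_integrand.
- move=> x x0; have s0 : 0 < Num.sqrt x by rewrite sqrtr_gt0.
  have d1 := dP _ s0; have d2 := is_derive1_sqrt x0.
  have d3 := is_derive1_comp d1 d2.
  apply: is_derive_eq; rewrite /GRing.scale /= /gauss_fun sqr_sqrtr ?ltW//.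
  have -> : (1 / 2 - 1 : R) = - 2^-1 by field.
  rewrite powRN powR12_sqrt ?ltW//; field; rewrite gt_eqF//.
- rewrite -[X in _ --> X](mulr0 2); apply: cvgM; first exact: cvg_cst.
  exact: (cvg_comp _ _ sq0 Pr).
- have -> : Num.sqrt pi = 2 * (Num.sqrt pi / 2) :> R by field.
  apply: cvgM; first exact: cvg_cst.
  exact: (cvg_comp _ _ sqy Py).
by rewrite /Gamma /Rintegral E /= subr0.
Unshelve. all: by end_near. Qed.

(** * The integrals of (1 + t^2)^(-N/2-1) *)

Lemma oneD_sqr_gt0 (R : realType) (t : R) : 0 < 1 + t ^+ 2.
Proof. by rewrite ltr_pwDl// sqr_ge0. Qed.

Lemma is_derive_powR_oneD_sqr (R : realType) (p x : R) :
  is_derive x 1 (fun t => (1 + t ^+ 2) `^ p)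
    (2 * p * x * (1 + x ^+ 2) `^ (p - 1)).
Proof.
have d1 := is_derive1_powR p (oneD_sqr_gt0 x).
have d2 : is_derive x 1 (fun t : R => 1 + t ^+ 2) (2 * x).
  by apply: is_derive_eq; rewrite /GRing.scale /=; ring.
have := is_derive1_comp (f := fun t => t `^ p) (g := fun t => 1 + t ^+ 2) d1 d2.
by move=> d3; apply: is_derive_eq; ring.
Qed.

Lemma continuous_powR_oneD_sqrV (R : realType) (p x : R) :
  {for x, continuous (fun t : R => ((1 + t ^+ 2) `^ p)^-1)}.
Proof.
rewrite (_ : (fun t => _) = fun t => (1 + t ^+ 2) `^ (- p)); last first.
  by apply/funext => t; rewrite powRN.
exact: is_derive_continuous (is_derive_powR_oneD_sqr _ _).
Qed.

(** Writing t^2 = (1 + t^2) - 1 in the product rule leaves only pure powers of 1 + t^2. For p = N/2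
    + 1 they are the integrands of [tail N.+2] and [tail N]; for p = 1/2 the second term vanishes
    and a primitive for N = 1 results. *)
Lemma is_derive_mul_powR_oneD_sqrV (R : realType) (p x : R) :
  is_derive x 1 (fun t => t * ((1 + t ^+ 2) `^ p)^-1)
    (2 * p * ((1 + x ^+ 2) `^ (p + 1))^-1 - (2 * p - 1) * ((1 + x ^+ 2) `^ p)^-1).
Proof.
under [X in is_derive _ _ X _]eq_fun do rewrite -powRN.
have d1 := is_derive_powR_oneD_sqr (- p) x.
apply: is_derive_eq; rewrite /GRing.scale /=.
have ne : 1 + x ^+ 2 != 0 by rewrite gt_eqF// oneD_sqr_gt0.
have -> : (1 + x ^+ 2) `^ (- p - 1) = ((1 + x ^+ 2) `^ (p + 1))^-1.
  by rewrite -powRN; congr powR; ring.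
rewrite powRN powRD ?ne ?implybT// powRr1 ?ltW ?oneD_sqr_gt0//.
have ne2 : (1 + x ^+ 2) `^ p != 0 by rewrite gt_eqF// powR_gt0// oneD_sqr_gt0.
by field; rewrite ne ne2.
Qed.

Lemma tail_oy (R : realType) (N : nat) (s : R) :
  tail N s = \int[@lebesgue_measure R]_(t in `]s, +oo[)
     ((1 + t ^+ 2) `^ (N%:R / 2 + 1))^-1.
Proof.
rewrite /tail /Rintegral -integral_itv_obnd_cbnd//.
apply/measurable_EFinP; apply: open_continuous_measurable_fun => // x _.
exact: continuous_powR_oneD_sqrV.
Qed.

Lemma cvgr_mul_powR_oneD_sqrV (R : realType) (p : R) : 1 <= p ->
  t * ((1 + t ^+ 2) `^ p)^-1 @[t --> +oo] --> (0 : R).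
Proof.
move=> p1; apply/cvgrPdist_lt => e e0; near=> t.
have t0 : 0 < t by near: t; exact: nbhs_pinfty_gt.
have p0 : 0 < (1 + t ^+ 2) `^ p by rewrite powR_gt0// oneD_sqr_gt0.
rewrite sub0r normrN ger0_norm ?mulr_ge0 ?invr_ge0 ?ltW//.
apply: (@le_lt_trans _ _ t^-1).
  rewrite ler_pdivrMr// mulrC ler_pdivlMr// -expr2.
  apply: (@le_trans _ _ (1 + t ^+ 2)); first by rewrite lerDr.
  apply: (@le_trans _ _ ((1 + t ^+ 2) `^ 1)).
    by rewrite powRr1// ltW// oneD_sqr_gt0.
  by apply: ler_powR => //; rewrite lerDl sqr_ge0.
rewrite -[ltRHS]invrK ltf_pV2 ?posrE ?invr_gt0//.
by near: t; apply: nbhs_pinfty_gt; exact: num_real.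
Unshelve. all: by end_near. Qed.

Lemma cvg0_mul_powR_oneD_sqrV (R : realType) (p : R) :
  t * ((1 + t ^+ 2) `^ p)^-1 @[t --> 0^'+] --> (0 : R).
Proof.
apply: cvg_at_right_filter.
have := is_derive_continuous (is_derive_mul_powR_oneD_sqrV p 0).
by rewrite /prop_for /continuous_at mul0r.
Qed.

Lemma tail0_rec (R : realType) (N : nat) :
  (N%:R + 2) * tail N.+2 0 = (N%:R + 1) * tail N 0 :> R.
Proof.
rewrite !tail_oy.
pose f (t : R) := ((1 + t ^+ 2) `^ (N.+2%:R / 2 + 1))^-1.
pose g (t : R) := ((1 + t ^+ 2) `^ (N%:R / 2 + 1))^-1.
have f0 t : 0 <= f t by rewrite invr_ge0 powR_ge0.
have g0 t : 0 <= g t by rewrite invr_ge0 powR_ge0.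
have cf t : {for t, continuous f} by exact: continuous_powR_oneD_sqrV.
have cg t : {for t, continuous g} by exact: continuous_powR_oneD_sqrV.
have n2 : 0 <= N%:R + 2 :> R by rewrite addr_ge0.
have n1 : 0 <= N%:R + 1 :> R by rewrite addr_ge0.
have h : (\int[lebesgue_measure]_(x in `]0%R, +oo[) ((N%:R + 2) * f x)%:E + 0%:E =
    \int[lebesgue_measure]_(x in `]0%R, +oo[) ((N%:R + 1) * g x)%:E + 0%:E)%E.
  apply: (@ge0_FTC_oy R (fun x => (N%:R + 2) * f x) (fun x => (N%:R + 1) * g x)
    (fun t => t * ((1 + t ^+ 2) `^ (N%:R / 2 + 1))^-1)).
  - by move=> x _; rewrite mulr_ge0.
  - by move=> x _; rewrite mulr_ge0.
  - by move=> x _; apply: continuousM; [exact: cst_continuous|exact: cf].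
  - by move=> x _; apply: continuousM; [exact: cst_continuous|exact: cg].
  - move=> x _; have d := is_derive_mul_powR_oneD_sqrV (N%:R / 2 + 1) x.
    apply: is_derive_eq; rewrite /f /g.
    have -> : N.+2%:R / 2 + 1 = N%:R / 2 + 1 + 1 :> R.
      by rewrite -[N.+2]addn2 natrD; field.
    by congr (_ * _ - _ * _); field.
  - exact: cvg0_mul_powR_oneD_sqrV.
  - by apply: cvgr_mul_powR_oneD_sqrV; rewrite lerDr divr_ge0.
(* A nonnegative constant passes through [fine] even when the integral is infinite, since both sides
   are then 0. *)
have Z (c : R) (k : R -> R) : 0 <= c -> (forall t, 0 <= k t) ->
    (forall t, {for t, continuous k}) ->
    c * (\int[@lebesgue_measure R]_(t in `]0%R, +oo[) k t) =
    fine (\int[@lebesgue_measure R]_(t in `]0%R, +oo[) (c * k t)%:E)%E.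
  move=> c0 k0 ck.
  have -> : (\int[lebesgue_measure]_(x in `]0%R, +oo[) (c * k x)%:E =
      c%:E * \int[lebesgue_measure]_(x in `]0%R, +oo[) (k x)%:E)%E.
    rewrite -ge0_integralZl_EFin//.
      by move=> x _; rewrite lee_fin.
    apply/measurable_EFinP; apply: open_continuous_measurable_fun => //.
    by move=> x _; exact: ck.
  rewrite /Rintegral; case: (\int[_]_(x in _) _)%E => [r| |] //=;
    rewrite mulr0; move: c0; rewrite le_eqVlt => /predU1P[<-|c0];
    by rewrite ?mul0e// ?gt0_muley ?gt0_muleNy ?lte_fin.
by rewrite (Z _ f n2 f0 cf) (Z _ g n1 g0 cg); move: h; rewrite !adde0 => ->.
Qed.

Lemma tail0_0 (R : realType) : tail 0 0 = pi / 2 :> R.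
Proof.
rewrite tail_oy /Rintegral.
have E : (\int[lebesgue_measure]_(t in `]0%R, +oo[)
    (((1 + t ^+ 2) `^ (0 / 2 + 1))^-1)%:E = (pi / 2 - 0 : R)%:E)%E.
  apply: (@ge0_FTC_oy0 R (fun t => ((1 + t ^+ 2) `^ (0 / 2 + 1))^-1) atan 0 0 (pi / 2)).
  - by move=> x _; rewrite invr_ge0 powR_ge0.
  - by move=> x _; exact: continuous_powR_oneD_sqrV.
  - move=> x _; have d := is_derive1_atan x; apply: is_derive_eq.
    by rewrite mul0r add0r powRr1 ?ltW ?oneD_sqr_gt0.
  - apply: cvg_at_right_filter; rewrite -[X in _ --> X](atan0 R).
    exact: continuous_atan.
  - exact: cvgy_atan.
by rewrite E subr0.
Qed.

Lemma tail1_0 (R : realType) : tail 1 0 = 1 :> R.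
Proof.
rewrite tail_oy /Rintegral.
have E : (\int[lebesgue_measure]_(t in `]0%R, +oo[)
    (((1 + t ^+ 2) `^ (1 / 2 + 1))^-1)%:E = (1 - 0 : R)%:E)%E.
  apply: (@ge0_FTC_oy0 R (fun t => ((1 + t ^+ 2) `^ (1 / 2 + 1))^-1)
    (fun t => t * ((1 + t ^+ 2) `^ (1 / 2))^-1) 0 0 1).
  - by move=> x _; rewrite invr_ge0 powR_ge0.
  - by move=> x _; exact: continuous_powR_oneD_sqrV.
  - move=> x _; have d := is_derive_mul_powR_oneD_sqrV (1 / 2) x; apply: is_derive_eq.
    by field; rewrite !gt_eqF// powR_gt0// oneD_sqr_gt0.
  - exact: cvg0_mul_powR_oneD_sqrV.
  - apply/cvgrPdist_lt => e e0; near=> t.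
    have t0 : 0 < t by near: t; exact: nbhs_pinfty_gt.
    rewrite div1r powR12_sqrt ?ltW ?oneD_sqr_gt0//.
    set q := Num.sqrt _.
    have q0 : 0 < q by rewrite sqrtr_gt0 oneD_sqr_gt0.
    have q2 : q ^+ 2 = 1 + t ^+ 2 by rewrite sqr_sqrtr// ltW// oneD_sqr_gt0.
    have tq : t < q by rewrite -ltr_sqr ?nnegrE ?ltW// q2 ltrDr.
    (* With t < q < t + 1 the distance (q - t) / q from t / q to 1 is below 1 / t. *)
    have qt : q < t + 1.
      rewrite -ltr_sqr ?nnegrE ?ltW ?addr_gt0// q2; nra.
    have -> : 1 - t / q = (q - t) / q by field; rewrite gt_eqF.
    rewrite ger0_norm ?divr_ge0 ?subr_ge0 ?ltW//.
    apply: (@lt_trans _ _ t^-1).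
      rewrite ltr_pdivrMr// mulrC ltr_pdivlMr//; nra.
    rewrite -[ltRHS]invrK ltf_pV2 ?posrE ?invr_gt0//.
    by near: t; apply: nbhs_pinfty_gt; exact: num_real.
by rewrite E subr0.
Unshelve. all: by end_near. Qed.

(** * Rotation invariance of the Lebesgue measure on the plane *)

Section measure_preserving.
Context d (T : measurableType d) (R : realType).
Variable mu : {measure set T -> \bar R}.
Implicit Types phi psi : T -> T.
Local Open Scope ereal_scope.

Definition measure_preserving phi :=
  measurable_fun setT phi /\ forall A, measurable A -> mu (phi @^-1` A) = mu A.

Lemma measure_preserving_comp phi psi :
  measure_preserving phi -> measure_preserving psi ->
  measure_preserving (phi \o psi).
Proof.
move=> [mphi hphi] [mpsi hpsi]; split; first exact: measurableT_comp.
move=> A mA; rewrite comp_preimage hpsi ?hphi//.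
by rewrite -[_ @^-1` _]setTI; exact: mphi.
Qed.

Import HBNNSimple.

(** The integral is a supremum over simple functions below [f], and h |-> h o phi carries them to
    simple functions below f o phi with the same integral. The argument covers arbitrary nonnegative
    [f]; equality then follows by applying it to the inverse map. *)
Lemma le_ge0_integral_comp phi (f : T -> \bar R) : measure_preserving phi ->
  (forall x, 0 <= f x) -> \int[mu]_x f x <= \int[mu]_x f (phi x).
Proof.
move=> [mphi hphi] f0; rewrite !ge0_integralTE//.
apply: ge_ereal_sup => _ /= [h hf <-].
have mhphi : measurable_fun setT (h \o phi) by exact: measurableT_comp.
have fhphi : finite_set (range (h \o phi)).
  apply: sub_finite_set (@fimfunP _ _ h) => _ [x _ <-].
  by exists (phi x).
have phphi x : (0 <= (h \o phi) x)%R by exact: fun_ge0.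
pose k : {nnsfun T >-> R} := HB.pack (h \o phi)
  (isMeasurableFun.Build _ _ _ _ _ mhphi) (FiniteImage.Build _ _ _ fhphi)
  (isNonNegFun.Build _ _ _ phphi).
apply: ereal_sup_ubound; exists k => /=; first by move=> x; exact: hf.
rewrite !sintegralET; apply: eq_fsbigr => r _.
rewrite /= comp_preimage hphi//.
Qed.

End measure_preserving.

Section measure_preserving_integral.
Context d (T : measurableType d) (R : realType).
Variable mu : {measure set T -> \bar R}.
Local Open Scope ereal_scope.

Lemma ge0_integral_measure_preserving (phi psi : T -> T) (f : T -> \bar R) :
  measure_preserving mu phi -> measure_preserving mu psi -> cancel psi phi ->
  (forall x, 0 <= f x) -> \int[mu]_x f (phi x) = \int[mu]_x f x.
Proof.
move=> mphi mpsi psiK f0; apply/eqP; rewrite eq_le le_ge0_integral_comp// andbT.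
have := @le_ge0_integral_comp _ _ _ mu psi (f \o phi) mpsi (fun x => f0 (phi x)).
by under [X in _ <= X -> _]eq_integral do rewrite /= psiK.
Qed.

Lemma integral_measure_preserving (phi psi : T -> T) (f : T -> \bar R) :
  measure_preserving mu phi -> measure_preserving mu psi -> cancel psi phi ->
  \int[mu]_x f (phi x) = \int[mu]_x f x.
Proof.
move=> mphi mpsi psiK; rewrite integralE [RHS]integralE; congr (_ - _).
  transitivity (\int[mu]_x f^\+ (phi x)).
    by apply: eq_integral => x _; rewrite !funeposE.
  by apply: (@ge0_integral_measure_preserving phi psi _ mphi mpsi psiK) => x; exact: funepos_ge0.
transitivity (\int[mu]_x f^\- (phi x)).
  by apply: eq_integral => x _; rewrite !funenegE.
by apply: (@ge0_integral_measure_preserving phi psi _ mphi mpsi psiK) => x; exact: funeneg_ge0.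
Qed.

(** The outer [fine] matters: if both parts of [f] have infinite integral, the integrals of [f] and
    of its negative are both [-oo], so negation commutes with integration only after infinite values
    are sent to 0. *)
Lemma fine_integralN D (f : T -> \bar R) :
  fine (\int[mu]_(x in D) (- f x)) = (- fine (\int[mu]_(x in D) f x))%R.
Proof.
rewrite integralE [in RHS]integralE funeposN funenegN.
have := integral_ge0 mu (D := D) (fun x _ => funepos_ge0 f x).
have := integral_ge0 mu (D := D) (fun x _ => funeneg_ge0 f x).
case: (\int[mu]_(x in D) f^\+ x) => [a| |]; case: (\int[mu]_(x in D) f^\- x) => [b| |] //=.
all: by rewrite ?opprB ?oppr0.
Qed.

End measure_preserving_integral.

Section plane.
Variable R : realType.
Notation mu := (@lebesgue_measure R).

Lemma lebesgue_measure_shift (a : R) (A : set R) : measurable A ->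
  mu ((fun y => y + a) @^-1` A) = mu A.
Proof.
move=> mA.
have ma : measurable_fun setT
    (fun y : measurableTypeR R => (y + a : measurableTypeR R)).
  exact: measurable_funD.
pose m : {measure set (measurableTypeR R) -> \bar R} :=
  measure_function_pushforward__canonical__measure_function_Measure mu ma.
apply/esym; transitivity (m A); last by [].
apply: (@lebesgue_measure_unique R m) => // _ [[x y] _ <-].
rewrite /m /= /pushforward.
have -> : (fun z => z + a) @^-1` `]x, y] = `]x - a, y - a]%classic.
  by apply/seteqP; split => z; rewrite /= !in_itv/= ltrBlDr lerBrDr.
rewrite !lebesgue_measure_itv/= !lte_fin ltrD2r; case: ifP => // _.
by rewrite -!EFinB; congr EFin; ring.
Qed.

Notation mu2 := (mu \x mu)%E.

Lemma measure_preserving_shear (a : R) :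
  measure_preserving mu2 (fun p => (p.1, p.2 + a * p.1)).
Proof.
have mS : measurable_fun setT
    (fun p : measurableTypeR R * measurableTypeR R => (p.1, p.2 + a * p.1)).
  apply: measurable_fun_pair => //; apply: measurable_funD => //.
  exact: measurable_funM.
(* The product measure integrates the measures of vertical sections, and the shear translates the
   section over x by a * x. *)
split => // A mA; rewrite /product_measure1 /=.
apply: eq_integral => x _ /=.
rewrite -[RHS](lebesgue_measure_shift (a * x)); last exact: measurable_xsection.
congr (mu _); apply/seteqP; split => y; rewrite /xsection /= !inE//.
Qed.

Lemma measure_preserving_swap : measure_preserving mu2 (fun p => (p.2, p.1)).
Proof.
have mS : measurable_fun setT (fun p : measurableTypeR R * measurableTypeR R => (p.2, p.1)).
  exact: measurable_fun_pair.
split => // A mA.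
apply/esym; apply: (@product_measure_unique _ _ _ _ _ mu mu
  (measure_function_pushforward__canonical__measure_function_Measure mu2 mS)) => //.
move=> B C mB mC /=; rewrite /pushforward.
rewrite (_ : _ @^-1` _ = C `*` B) ?product_measure1E// 1?muleC//.
by apply/seteqP; split => -[x y] /= [].
Qed.

Definition rotate (t : R) (p : R * R) :=
  (cos t * p.1 - sin t * p.2, cos t * p.2 + sin t * p.1).

(* A rotation is a product of three shears. *)
Lemma measure_preserving_rotate (t : R) : cos (t / 2) != 0 ->
  measure_preserving mu2 (rotate t).
Proof.
move=> ct.
(* Conjugating the vertical shear [S] by the swap [w] gives the horizontal shears; the pole of
   [tan (t / 2)] accounts for the hypothesis on [cos (t / 2)]. *)
pose S a p : R * R := (p.1, p.2 + a * p.1); pose w (p : R * R) := (p.2, p.1).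
have -> : rotate t = w \o S (- tan (t / 2)) \o w \o S (sin t) \o
    w \o S (- tan (t / 2)) \o w.
  have ht : t = t / 2 + t / 2 by field.
  have cE : cos t = cos (t / 2) ^+ 2 - sin (t / 2) ^+ 2.
    by rewrite {1}ht cosD !expr2.
  have sE : sin t = 2 * sin (t / 2) * cos (t / 2) by rewrite {1}ht sinD; ring.
  have := cos2Dsin2 (t / 2) => e1.
  apply/funext => -[x y]; rewrite /rotate /= /tan cE sE.
  have {}e1 : sin (t / 2) ^+ 2 = 1 - cos (t / 2) ^+ 2 by move: e1; lra.
  set c := cos (t / 2) in ct e1 *; set s := sin (t / 2) in e1 *.
  congr (_, _); rewrite /S /w /=.
    have -> : x + - (s / c) * y + - (s / c) * (y + 2 * s * c * (x + - (s / c) * y)) =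
        x * (1 - 2 * s ^+ 2) + y * (2 * s / c) * (s ^+ 2 - 1) by field.
    by rewrite e1; field.
  have -> : y + 2 * s * c * (x + - (s / c) * y) = 2 * s * c * x + y * (1 - 2 * s ^+ 2).
    by field.
  by rewrite e1; ring.
do ! apply: measure_preserving_comp;
  by [exact: measure_preserving_swap|exact: measure_preserving_shear].
Qed.

Lemma rotateK (t : R) : cancel (rotate (- t)) (rotate t).
Proof.
have e := cos2Dsin2 t; move=> [x y]; rewrite /rotate /= cosN sinN.
congr (_, _).
  by transitivity ((cos t ^+ 2 + sin t ^+ 2) * x); [ring|rewrite e mul1r].
by transitivity ((cos t ^+ 2 + sin t ^+ 2) * y); [ring|rewrite e mul1r].
Qed.

Lemma normc_cis (t : R) : normc (cis t) = 1.
Proof. by rewrite /= cos2Dsin2 sqrtr1. Qed.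

Lemma Rintegral_disk_rotate (f : R * R -> R) (t : R) : cos (t / 2) != 0 ->
  let D := [set p : R * R | normc (p.1 +i* p.2) < 1] in
  \int[mu2]_(p in D) f (rotate t p) = \int[mu2]_(p in D) f p.
Proof.
move=> ct D; congr fine; rewrite integral_mkcond [RHS]integral_mkcond.
rewrite -[RHS](integral_measure_preserving _ (measure_preserving_rotate ct)
  (@measure_preserving_rotate (- t) _) (@rotateK t)); last first.
  by rewrite mulNr cosN.
apply: eq_integral => p _; rewrite !patchE.
suff -> : (rotate t p \in D) = (p \in D) by [].
suff E : D (rotate t p) = D p.
  by apply/idP/idP => /set_mem h; apply/mem_set; move: h; rewrite E.
rewrite -[LHS]/(is_true (normc (cis t * (p.1 +i* p.2)) < 1)).
by rewrite Normc.normcM normc_cis mul1r.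
Qed.

(** Multiplication by ['i] sends (Re, Im) to (-Im, Re). Rotation invariance of each part thus gives
    two relations, Re = -Im and Re = Im between the integrals, which force both to be 0. *)
Lemma disk_integral_eq0 (F : R[i] -> R[i]) (t : R) : cos (t / 2) != 0 ->
  (forall w, F (cis t * w) = 'i%C * F w) -> disk_integral F = 0.
Proof.
move=> ct hF; rewrite /disk_integral /Cintegral.
set D := [set p | _].
pose u (p : R * R) := complex.Re (F (p.1 +i* p.2)).
pose v (p : R * R) := complex.Im (F (p.1 +i* p.2)).
have hu p : u (rotate t p) = - v p.
  by rewrite /u /v -[_ +i* _]/(cis t * (p.1 +i* p.2)) hF; case: (F _) => a b /=; ring.
have hv p : v (rotate t p) = u p.
  by rewrite /u /v -[_ +i* _]/(cis t * (p.1 +i* p.2)) hF; case: (F _) => a b /=; ring.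
have := Rintegral_disk_rotate v ct; have := Rintegral_disk_rotate u ct.
rewrite /= -/D; under eq_Rintegral do rewrite hu.
move=> h1; under eq_Rintegral do rewrite hv.
move=> h2; rewrite -/(u _) -/(v _).
have h3 : \int[mu2]_(x in D) - v x = - \int[mu2]_(x in D) v x.
  by rewrite /Rintegral -fine_integralN.
have [e1 e2] : \int[mu2]_(x in D) v x = 0 /\ \int[mu2]_(x in D) u x = 0.
  move: h1 h2; rewrite h3; 
  set a := (\int[mu2]_(x in D) v x); set b := (\int[mu2]_(x in D) u x).
  by clearbody a b; clear => h1 h2; split; lra.
transitivity ((\int[mu2]_(x in D) u x) +i* (\int[mu2]_(x in D) v x)); first by [].
by rewrite e1 e2.
Qed.

End plane.

(** * The tail at 0 as a Gamma quotient and through central binomial coefficients *)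

Lemma Gamma_half_nat_gt0 (R : realType) (n : nat) : 0 < Gamma ((n%:R + 1) / 2) :> R.
Proof.
elim/ltn_ind: n => -[|[|n]] IH.
- by rewrite add0r Gamma_half sqrtr_gt0 pi_gt0.
- by rewrite (_ : (1 + 1) / 2 = 1) ?Gamma_1//; field.
have -> : (n.+2%:R + 1) / 2 = (n%:R + 1) / 2 + 1 :> R.
  by rewrite -[n.+2]addn2 natrD; field.
have n1 : 0 < (n%:R + 1) / 2 :> R by rewrite divr_gt0// ltr_wpDl.
by rewrite GammaD1// mulr_gt0// IH.
Qed.

Lemma tail0_Gamma (R : realType) (n : nat) :
  tail n 0 = Num.sqrt pi / 2 * (Gamma ((n%:R + 1) / 2) / Gamma (n%:R / 2 + 1)) :> R.
Proof.
have spi : Num.sqrt pi ^+ 2 = pi :> R by rewrite sqr_sqrtr// pi_ge0.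
have spi0 : Num.sqrt pi != 0 :> R by rewrite gt_eqF// sqrtr_gt0 pi_gt0.
elim/ltn_ind: n => -[|[|n]] IH.
- rewrite tail0_0 add0r mul0r add0r Gamma_half Gamma_1 -{1}spi; by field.
- rewrite tail1_0 (_ : (1 + 1) / 2 = 1 :> R); last by field.
  by rewrite Gamma_1 GammaD1// Gamma_half; field.
have g1 : (n.+2%:R + 1) / 2 = (n%:R + 1) / 2 + 1 :> R.
  by rewrite -[n.+2]addn2 natrD; field.
have g2 : n.+2%:R / 2 + 1 = (n%:R / 2 + 1) + 1 :> R.
  by rewrite -[n.+2]addn2 natrD; field.
have n1 : 0 < (n%:R + 1) / 2 :> R by rewrite divr_gt0// ltr_wpDl.
have n2 : 0 < n%:R / 2 + 1 :> R by rewrite ltr_wpDl// divr_ge0.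
have n2' : n%:R + 2 != 0 :> R by rewrite gt_eqF// ltr_wpDl.
have IHn := IH n (leqnSn n.+1).
apply: (mulfI n2'); rewrite tail0_rec IHn g1 g2 (GammaD1 n1) (GammaD1 n2).
have G0 : Gamma (n%:R / 2 + 1) != 0 :> R.
  rewrite (_ : n%:R / 2 + 1 = (n.+1%:R + 1) / 2); last by rewrite -natr1; field.
  by rewrite gt_eqF// Gamma_half_nat_gt0.
by field; rewrite G0 n2'.
Qed.

(** For N = 2h + 1 this is what makes the coefficient of x^h in the multiple of (1 + x)^(2h)
    produced by the skew products equal to 1, as the definition of q_{N-1} demands. *)
Lemma tail0_central_binomial (R : realType) (h : nat) :
  tail h.*2.+1 0 * (h.*2.+1)%:R * 'C(h.*2, h)%:R = 2 ^+ h.*2 :> R.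
Proof.
elim: h => [|h IH]; first by rewrite tail1_0 bin0 !mul1r expr0.
have rec := tail0_rec R h.*2.+1.
have binE : (h.+1)%:R * 'C(h.+1.*2, h.+1)%:R = 2 * (h.*2.+1)%:R * 'C(h.*2, h)%:R :> R.
  rewrite -!natrM; congr _%:R; apply/eqP.
  rewrite -(eqn_pmul2l (ltn0Sn h)); apply/eqP.
  have e0 := mul_bin_diag h.+1.*2 h; have e1 := mul_bin_diag h.*2.+1 h.
  rewrite doubleS /= in e0; rewrite /= in e1.
  have e2 : ('C(h.*2.+1, h) = 'C(h.*2.+1, h.+1))%N.
    rewrite -[LHS]bin_sub; last by rewrite -addnn -addSn leq_addl.
    by congr 'C(_, _); rewrite -addnn -addSn addnK.
  by rewrite doubleS -e0 e2 -doubleS -muln2; nia.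
rewrite doubleS !exprS -IH.
have -> : (h.*2.+3)%:R = (h.*2.+1)%:R + 2 :> R by rewrite -natrD addn2.
have e : (h.*2.+1)%:R + 1 = 2 * (h.+1)%:R :> R.
  by rewrite natr1 -natrM mul2n doubleS.
rewrite e in rec.
transitivity (2 * tail h.*2.+1 0 * (h.+1%:R * 'C(h.+1.*2, h.+1)%:R) : R).
  by rewrite doubleS [tail _ _ * _]mulrC rec; ring.
by rewrite binE; ring.
Qed.

(** * Polar coordinates and integrals over the circle *)

Section cis.
Variable R : realType.
Implicit Types (t x r : R) (k : nat).

Lemma cisD t x : cis (t + x) = cis t * cis x.
Proof. by rewrite /cis cosD sinD; congr (_ +i* _); ring. Qed.

Lemma cis0 : cis (0 : R) = 1.
Proof. by rewrite /cis cos0 sin0. Qed.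

Lemma cis_neq0 t : cis t != 0.
Proof.
apply/eqP => h; have := normc_cis t; rewrite h Normc.normc0 => /eqP.
by rewrite eq_sym oner_eq0.
Qed.

Lemma cisN t : cis (- t) = (cis t)^-1.
Proof. by apply: (mulfI (cis_neq0 t)); rewrite -cisD subrr cis0 mulfV// cis_neq0. Qed.

Lemma cisX t k : cis t ^+ k = cis (k%:R * t).
Proof.
elim: k => [|k IH]; first by rewrite mul0r cis0.
by rewrite exprS IH -cisD -natr1; congr cis; ring.
Qed.

Lemma normc_polar r t : 0 <= r -> normc (r%:C * cis t) = r.
Proof.
by move=> r0; rewrite Normc.normcM normc_cis mulr1 /= expr0n addr0 sqrtr_sqr ger0_norm.
Qed.

Lemma cos_eq1 x : 0 <= x < 2 * pi -> cos x = 1 -> x = 0.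
Proof.
move=> /andP[x0 x2] c1; apply/eqP; move: x0; rewrite le_eqVlt eq_sym => /predU1P[->//|x0].
have : 0 < sin (x / 2).
  by apply: sin_gt0_pi; rewrite divr_gt0//= ltr_pdivrMr// mulrC.
move=> s0; have : cos x = 1 - 2 * sin (x / 2) ^+ 2.
  have -> : cos x = cos (x / 2 + x / 2) by congr cos; field.
  by rewrite cosD; have := cos2Dsin2 (x / 2) => e; nra.
rewrite c1 => e; suff : sin (x / 2) ^+ 2 = 0 by move/eqP; rewrite sqrf_eq0 gt_eqF.
lra.
Qed.

Lemma cis_inj t x : 0 <= t < 2 * pi -> 0 <= x < 2 * pi -> cis t = cis x -> t = x.
Proof.
wlog tx : t x / x <= t.
  move=> H; case/orP: (le_total x t) => tx ht hx e; first exact: H.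
  by apply/esym; apply: H.
move=> /andP[t0 t2] /andP[x0 x2] e; apply/eqP; rewrite -subr_eq0; apply/eqP.
apply: cos_eq1.
  by rewrite subr_ge0 tx /=; apply: le_lt_trans t2; rewrite lerBlDr lerDl.
have : cis (t - x) = 1 by rewrite cisD cisN e mulfV// cis_neq0.
by move/(congr1 (@complex.Re R)).
Qed.

Lemma argc_polar r t : 0 < r -> 0 <= t < 2 * pi -> argc (r%:C * cis t) = t.
Proof.
move=> r0 ht; rewrite /argc normc_polar ?ltW//.
apply: xget_unique => // x [hx /= e].
have rC : r%:C != 0 :> R[i] by rewrite eq_complex /= gt_eqF.
by apply: cis_inj => //; apply/esym/(mulfI rC).
Qed.

Lemma argc_cis t : 0 <= t < 2 * pi -> argc (cis t) = t.
Proof. by move=> ht; rewrite -[cis t]mul1r; exact: (argc_polar ltr01 ht). Qed.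

Lemma inv_conjc_polar r t : (conjc (r%:C * cis t))^-1 = (r^-1)%:C * cis t.
Proof.
have -> : conjc (r%:C * cis t) = r%:C * cis (- t).
  by rewrite /cis cosN sinN /=; congr (_ +i* _); ring.
by rewrite cisN invfM invrK fmorphV.
Qed.

End cis.

Section circle_integrals.
Variable R : realType.
Notation mu := (@lebesgue_measure R).
Implicit Types (f F g : R -> R) (a b m t : R).

Lemma continuous_FTC2_le f F a b : a <= b -> continuous f ->
  (forall x : R, is_derive x 1 F (f x)) ->
  (\int[mu]_(x in `[a, b]) (f x)%:E = (F b - F a)%:E)%E.
Proof.
rewrite le_eqVlt => /predU1P[<- _ _|ab cf dF].
  by rewrite set_itv1 integral_set1 subrr.
rewrite (@continuous_FTC2 R f F a b ab)//.
- exact: continuous_subspaceT.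
- have cF x : {for x, continuous F} by exact: is_derive_continuous (dF x).
  split.
  + by move=> x _; have d := dF x; exact: ex_derive.
  + exact: cvg_at_right_filter (cF _).
  + exact: cvg_at_left_filter (cF _).
- by move=> x _; have d := dF x; rewrite derive1E derive_val.
Qed.

Lemma Rintegral_FTC2 f F a b : a <= b -> continuous f ->
  (forall x : R, is_derive x 1 F (f x)) ->
  \int[mu]_(x in `[a, b]) f x = F b - F a.
Proof. by move=> ab cf dF; rewrite /Rintegral (continuous_FTC2_le ab cf dF). Qed.

(** At 2 pi the argument falls back to 0, so the circle integrands agree with their closed forms
    only on [0, 2 pi). The right endpoint is a null set, and measurability is asked of the closed
    form only. *)
Lemma Rintegral_bndo_eq f g a b : measurable_fun setT g ->
  (forall t, a <= t < b -> f t = g t) ->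
  \int[mu]_(t in `[a, b]) f t = \int[mu]_(t in `[a, b]) g t.
Proof.
move=> mg fg; congr fine.
have mg' : measurable_fun `[a, b[ g by exact: measurable_funTS.
have E : {in `[a, b[%classic, g =1 f}.
  by move=> t /set_mem; rewrite /= in_itv/= => h; rewrite fg.
rewrite -integral_itv_bndo_bndc; last first.
  by apply/measurable_EFinP; apply: eq_measurable_fun mg'.
rewrite -[RHS]integral_itv_bndo_bndc; last exact/measurable_EFinP.
by apply: eq_integral => t tab; rewrite E.
Qed.

Lemma measurable_sgB a : measurable_fun setT (fun t : R => Num.sg (t - a)).
Proof.
have -> : (fun t : R => Num.sg (t - a)) =
    (fun t => \1_(`]a, +oo[%classic) t - \1_(`]-oo, a[%classic) t).
  apply/funext => t; rewrite !indicE /= !mem_setE/= !in_itv/= andbT.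
  case: (ltgtP t a) => h.
  - by rewrite ltr0_sg ?subr_lt0// sub0r.
  - by rewrite gtr0_sg ?subr_gt0// subr0.
  - by rewrite h subrr sgr0 subr0.
by apply: measurable_funB; exact: measurable_indic.
Qed.

Lemma Rintegral_sg f F a b c : a <= c <= b -> continuous f ->
  (forall x : R, is_derive x 1 F (f x)) ->
  \int[mu]_(t in `[a, b]) (f t * Num.sg (t - c)) = F b + F a - 2 * F c.
Proof.
move=> /andP[ac cb] cf dF; rewrite /Rintegral.
have mf : measurable_fun setT f by exact: continuous_measurable_fun.
have mfs : measurable_fun setT (fun t => f t * Num.sg (t - c)).
  by apply: measurable_funM => //; exact: measurable_sgB.
have mEf A : measurable_fun A (EFin \o f).
  by apply/measurable_EFinP; exact: measurable_funTS.
have mEfs A : measurable_fun A (EFin \o (fun t => f t * Num.sg (t - c))).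
  by apply/measurable_EFinP; exact: measurable_funTS.
have mENf A : measurable_fun A (EFin \o (fun t => - f t)).
  by apply/measurable_EFinP; apply: measurable_funTS; exact: measurableT_comp.
have abE : `[a, b]%classic = `[a, c[%classic `|` `[c, b]%classic.
  by rewrite -itv_bndbnd_setU// bnd_simp.
have cNf : continuous (fun t => - f t) by move=> t; apply: cvgN; exact: cf.
have dNF (x : R) : is_derive x 1 (fun t => - F t) (- f x).
  by have d := dF x; apply: is_derive_eq.
have I1 : (\int[mu]_(t in `[a, c[) (f t * Num.sg (t - c))%:E =
    (- F c - - F a)%:E)%E.
  rewrite -(continuous_FTC2_le ac cNf dNF) -integral_itv_bndo_bndc//.
  apply: eq_integral => t /set_mem; rewrite /= in_itv/= => /andP[_ tc].
  by rewrite ltr0_sg ?subr_lt0// mulrN1.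
have I2 : (\int[mu]_(t in `[c, b]) (f t * Num.sg (t - c))%:E = (F b - F c)%:E)%E.
  rewrite -(continuous_FTC2_le cb cf dF) -[LHS]integral_itv_obnd_cbnd//.
  rewrite -[RHS]integral_itv_obnd_cbnd//.
  apply: eq_integral => t /set_mem; rewrite /= in_itv/= => /andP[tc _].
  by rewrite gtr0_sg ?subr_gt0// mulr1.
have mU : measurable_fun (`[a, c[%classic `|` `[c, b]%classic)
    (fun t => f t * Num.sg (t - c)) by exact: measurable_funTS.
have dU : [disjoint `[a, c[%classic & `[c, b]%classic].
  rewrite disj_set2E; apply/eqP/seteqP; split => // t [] /=; rewrite !in_itv/=.
  by move=> /andP[_ tc] /andP[ct _]; move: (lt_le_trans tc ct); rewrite ltxx.
rewrite abE integral_setU_EFin//.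
by rewrite I1 I2 /=; ring.
Qed.

Lemma is_derive_cosM m (x : R) : is_derive x 1 (fun t => cos (m * t)) (- (m * sin (m * x))).
Proof.
have d1 := is_derive_cos (m * x).
have d2 : is_derive x 1 (fun t => m * t) m.
  by apply: is_derive_eq; rewrite /GRing.scale /= mulr1.
have d := is_derive1_comp (f := cos) (g := fun t => m * t) d1 d2.
by apply: is_derive_eq; ring.
Qed.

Lemma is_derive_sinM m (x : R) : is_derive x 1 (fun t => sin (m * t)) (m * cos (m * x)).
Proof.
have d1 := is_derive_sin (m * x).
have d2 : is_derive x 1 (fun t => m * t) m.
  by apply: is_derive_eq; rewrite /GRing.scale /= mulr1.
have d := is_derive1_comp (f := sin) (g := fun t => m * t) d1 d2.
by apply: is_derive_eq; ring.
Qed.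

Lemma continuous_cosM m : continuous (fun t => cos (m * t)).
Proof. by move=> x; exact: is_derive_continuous (is_derive_cosM m x). Qed.

Lemma continuous_sinM m : continuous (fun t => sin (m * t)).
Proof. by move=> x; exact: is_derive_continuous (is_derive_sinM m x). Qed.

Lemma circle_integral_cis_sg (h : R -> R[i]) (c m p : R) : m != 0 ->
  0 <= p <= 2 * pi ->
  (forall t, 0 <= t < 2 * pi -> h t = c%:C * cis (m * t) * (Num.sg (t - p))%:C) ->
  circle_integral h =
    c%:C * (cis (m * (2 * pi)) + 1 - 2 * cis (m * p)) / ('i%C * m%:C).
Proof.
move=> m0 hp hE; rewrite /circle_integral /Cintegral.
have pi2 : 0 <= 2 * pi :> R by rewrite mulr_ge0// pi_ge0.
rewrite (@Rintegral_bndo_eq _ (fun t => c * cos (m * t) * Num.sg (t - p))); first last.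
- by move=> t ht; apply: (etrans (congr1 (@complex.Re R) (hE t ht))); rewrite /=; ring.
- apply: measurable_funM; last exact: measurable_sgB.
  by apply: measurable_funM => //; apply: continuous_measurable_fun; exact: continuous_cosM.
rewrite [X in _ +i* X](@Rintegral_bndo_eq _
  (fun t => c * sin (m * t) * Num.sg (t - p))); first last.
- by move=> t ht; apply: (etrans (congr1 (@complex.Im R) (hE t ht))); rewrite /=; ring.
- apply: measurable_funM; last exact: measurable_sgB.
  by apply: measurable_funM => //; apply: continuous_measurable_fun; exact: continuous_sinM.
have c1 : continuous (fun t => c * cos (m * t)).
  by move=> t; apply: cvgM; [exact: cvg_cst|exact: continuous_cosM].
have c2 : continuous (fun t => c * sin (m * t)).
  by move=> t; apply: cvgM; [exact: cvg_cst|exact: continuous_sinM].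
have d1 (x : R) : is_derive x 1 (fun t => c * (sin (m * t) / m)) (c * cos (m * x)).
  have d := is_derive_sinM m x; apply: is_derive_eq.
  by rewrite /GRing.scale /=; field.
have d2 (x : R) : is_derive x 1 (fun t => - (c * (cos (m * t) / m))) (c * sin (m * x)).
  have d := is_derive_cosM m x; apply: is_derive_eq.
  by rewrite /GRing.scale /=; field.
rewrite (Rintegral_sg hp c1 d1) (Rintegral_sg hp c2 d2).
rewrite mulr0 cos0 sin0 mul0r mulr0.
have i0 : 'i%C * m%:C != 0 :> R[i].
  by rewrite mulf_neq0// eq_complex /= ?oner_eq0 ?(negbTE m0) ?andbF.
apply: (mulIf i0); rewrite divfK// /cis.
apply/eqP; rewrite eq_complex /=; apply/andP; split; apply/eqP; by field.
Qed.

Lemma circle_integral_sg (h : R -> R[i]) (c : R[i]) (p : R) : 0 <= p <= 2 * pi ->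
  (forall t, 0 <= t < 2 * pi -> h t = c * (Num.sg (t - p))%:C) ->
  circle_integral h = c * (2 * pi - 2 * p)%:C.
Proof.
case: c => a b hp hE; rewrite /circle_integral /Cintegral.
rewrite (@Rintegral_bndo_eq _ (fun t => a * Num.sg (t - p))); first last.
- by move=> t ht; apply: (etrans (congr1 (@complex.Re R) (hE t ht))); rewrite /=; ring.
- by apply: measurable_funM => //; exact: measurable_sgB.
rewrite [X in _ +i* X](@Rintegral_bndo_eq _ (fun t => b * Num.sg (t - p))); first last.
- by move=> t ht; apply: (etrans (congr1 (@complex.Im R) (hE t ht))); rewrite /=; ring.
- by apply: measurable_funM => //; exact: measurable_sgB.
have d1 (c x : R) : is_derive x 1 (fun t => c * t) c.
  by apply: is_derive_eq; rewrite /GRing.scale /= mulr1.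
rewrite (Rintegral_sg (f := fun=> a) hp (@cst_continuous _ _ a) (d1 a)).
rewrite (Rintegral_sg (f := fun=> b) hp (@cst_continuous _ _ b) (d1 b)).
by apply/eqP; rewrite eq_complex /=; apply/andP; split; apply/eqP; ring.
Qed.

(** The outer integral of the skew product of x^k with x^(M/2): the inner integral of the sign
    function produces the affine factor. *)
Lemma circle_integral_cis_affine (h : R -> R[i]) (c m : R) : m != 0 ->
  cis (m * (2 * pi)) = 1 ->
  (forall t, 0 <= t < 2 * pi -> h t = c%:C * cis (m * t) * (2 * pi - 2 * t)%:C) ->
  circle_integral h = c%:C * (4 * pi / m)%:C * 'i%C.
Proof.
move=> m0 hm hE; rewrite /circle_integral /Cintegral.
have pi2 : 0 <= 2 * pi :> R by rewrite mulr_ge0// pi_ge0.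
have hc : cos (m * (2 * pi)) = 1 by move/(congr1 (@complex.Re R)): hm.
have hs : sin (m * (2 * pi)) = 0 by move/(congr1 (@complex.Im R)): hm.
have cA : continuous (fun t : R => 2 * pi - 2 * t).
  by move=> t; apply: cvgB; [exact: cvg_cst|apply: cvgM => //; exact: cvg_cst].
have cc : continuous (fun t => c * (cos (m * t) * (2 * pi - 2 * t))).
  move=> t; apply: cvgM; first exact: cvg_cst.
  by apply: cvgM; [exact: continuous_cosM|exact: cA].
have cs : continuous (fun t => c * (sin (m * t) * (2 * pi - 2 * t))).
  move=> t; apply: cvgM; first exact: cvg_cst.
  by apply: cvgM; [exact: continuous_sinM|exact: cA].
rewrite (@Rintegral_bndo_eq _ (fun t => c * (cos (m * t) * (2 * pi - 2 * t)))); first last.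
- by move=> t ht; apply: (etrans (congr1 (@complex.Re R) (hE t ht))); rewrite /=; ring.
- exact: continuous_measurable_fun.
rewrite [X in _ +i* X](@Rintegral_bndo_eq _
  (fun t => c * (sin (m * t) * (2 * pi - 2 * t)))); first last.
- by move=> t ht; apply: (etrans (congr1 (@complex.Im R) (hE t ht))); rewrite /=; ring.
- exact: continuous_measurable_fun.
have e1 (x : R) : is_derive x 1 (fun t => c * ((2 * pi - 2 * t) * sin (m * t) / m
    - 2 * cos (m * t) / m ^+ 2)) (c * (cos (m * x) * (2 * pi - 2 * x))).
  have d1 := is_derive_sinM m x; have d2 := is_derive_cosM m x.
  by apply: is_derive_eq; rewrite /GRing.scale /=; field.
have e2 (x : R) : is_derive x 1 (fun t => c * (- (2 * pi - 2 * t) * cos (m * t) / m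
    - 2 * sin (m * t) / m ^+ 2)) (c * (sin (m * x) * (2 * pi - 2 * x))).
  have d1 := is_derive_sinM m x; have d2 := is_derive_cosM m x.
  by apply: is_derive_eq; rewrite /GRing.scale /=; field.
rewrite (Rintegral_FTC2 pi2 cc e1) (Rintegral_FTC2 pi2 cs e2).
rewrite hc hs !mulr0 sin0 cos0.
by apply/eqP; rewrite eq_complex /=; apply/andP; split; apply/eqP; field.
Qed.

End circle_integrals.

(** * Binomial sums *)

Section pairing.
Variable V : nmodType.
Implicit Types (F : nat -> V) (n h : nat).

Lemma sum_even_odd F n h :
  \sum_(l < n | (2 * l < h)%N) F (2 * l)%N + \sum_(l < n | (2 * l + 1 < h)%N) F (2 * l + 1)%N
  = \sum_(k < 2 * n | (k < h)%N) F k.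
Proof.
elim: n => [|n IH]; first by rewrite muln0 !big_ord0 addr0.
rewrite big_mkcond [X in _ + X]big_mkcond !big_ord_recr /= -!big_mkcond /=.
rewrite addrACA IH (_ : (2 * n.+1 = (2 * n).+2)%N); last by lia.
rewrite [in RHS]big_mkcond !big_ord_recr /= -big_mkcond /= -addrA addn1.
by [].
Qed.

Lemma sum_pairs_even F n :
  \sum_(l < n) (F (2 * l)%N + F (2 * n - 1 - 2 * l)%N) = \sum_(k < 2 * n) F k.
Proof.
rewrite big_split /= [X in _ + X](reindex_inj rev_ord_inj) /=.
transitivity (\sum_(k < 2 * n | (k < 2 * n)%N) F k); last first.
  by apply: eq_bigl => k; rewrite ltn_ord.
rewrite -sum_even_odd; congr (_ + _).
  by apply: eq_bigl => l; have := ltn_ord l; lia.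
apply: eq_big => [l|l _]; first by have := ltn_ord l; lia.
by congr F; have := ltn_ord l; lia.
Qed.

(** The unordered pairs {j, 2h - j} are indexed by j < h. For 2l < h the pair is that of the even
    number 2l; otherwise 2h - (2l + 1) = 2(h - 1 - l) + 1 is an odd number below h, so reversing l
    lists the odd j. *)
Lemma sum_pairs_odd F h (k := fun l => if (2 * l < h)%N then (2 * l)%N else (2 * l + 1)%N) :
  \sum_(l < h) (F (k l) + F (2 * h - k l)%N) = \sum_(j < (2 * h).+1 | j != h :> nat) F j.
Proof.
pose G j := F j + F (2 * h - j)%N.
have GS j : (j <= 2 * h)%N -> G (2 * h - j)%N = G j.
  by move=> jh; rewrite /G subKn// addrC.
transitivity (\sum_(j < h) G j).
  transitivity (\sum_(l < h | (2 * l < h)%N) G (2 * l)%N +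
      \sum_(l < h | (2 * l + 1 < h)%N) G (2 * l + 1)%N); last first.
    rewrite sum_even_odd -(big_mkord (fun j => (j < h)%N)) -(big_mkord xpredT).
    rewrite (@big_cat_nat _ _ _ h) ?leq_pmull//=.
    rewrite [X in _ + X]big_nat_cond [X in _ + X]big1 ?addr0.
      by rewrite big_nat_cond [RHS]big_nat_cond; apply: eq_bigl => j; lia.
    by move=> j; lia.
  rewrite (bigID (fun l : 'I_h => (2 * l < h)%N)) /=; congr (_ + _).
    by apply: eq_bigr => l lh; rewrite /G /k lh.
  rewrite (reindex_inj rev_ord_inj) /=.
  apply: eq_big => [l|l]; first by have := ltn_ord l; lia.
  move=> /negbTE lh; rewrite /k lh -GS; last by have := ltn_ord l; lia.
  by rewrite -/(G _); congr G; have := ltn_ord l; lia.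
rewrite /G big_split /= [X in _ + X](reindex_inj rev_ord_inj) /=.
rewrite -(big_mkord (fun j => j != h)) -(big_mkord xpredT F).
rewrite -(big_mkord xpredT (fun j => F (2 * h - (h - j.+1))%N)).
rewrite [RHS](@big_cat_nat _ _ _ h) //=.
congr (_ + _).
  by rewrite [RHS]big_nat_cond big_nat_cond; apply: eq_bigl => j; lia.
rewrite [RHS]big_ltn_cond; last by lia.
rewrite eqxx /= [RHS](_ : _ = \sum_(0 + h.+1 <= i < (2 * h).+1 | i != h) F i)//.
rewrite big_addn.
rewrite (_ : ((2 * h).+1 - h.+1 = h)%N); last by lia.
rewrite big_nat_cond [RHS]big_nat_cond; apply: eq_big => [j|j]; first by lia.
by move=> /andP[/andP[_ jh] _]; congr F; lia.
by lia.
Qed.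

End pairing.

Section bimon.
Variable K : fieldType.
Implicit Types (y z : K) (M k : nat).

(* [y ^ (2 k - M)], with only natural exponents *)
Definition bimon M k y : K := y ^+ k * y^-1 ^+ (M - k).

Lemma bimonV M k y : (k <= M)%N -> bimon M (M - k) y = bimon M k y^-1.
Proof. by move=> kM; rewrite /bimon invrK subKn// mulrC. Qed.

Lemma bimonM M k y z : bimon M k (y * z) = bimon M k y * bimon M k z.
Proof. by rewrite /bimon invfM !exprMn; ring. Qed.

Lemma sum_bimon M y :
  \sum_(k < M.+1) 'C(M, k)%:R * bimon M k y = (y + y^-1) ^+ M.
Proof.
rewrite addrC exprDn; apply: eq_bigr => k _.
by rewrite /bimon mulr_natl; congr (_ *+ _); exact: mulrC.
Qed.

(** This is y d/dy applied to [sum_bimon], proved by the absorption identities for k C(M, k) and (M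
    - k) C(M, k). The exponent is the integer N - 2, equal to -1 at M = 0, where the factor M makes
    both sides vanish. *)
Lemma sum_bimon_deriv M y :
  \sum_(k < M.+1) (2 * k%:R - M%:R) * 'C(M, k)%:R * bimon M k y =
  M%:R * (y + y^-1) ^ (M.+1%:Z - 2) * (y - y^-1).
Proof.
case: M => [|m].
  by rewrite big_ord_recl big_ord0 mulr0 subrr !mul0r addr0.
rewrite (_ : m.+2%:Z - 2 = m); last by lia.
rewrite -[_ ^ _]/(_ ^+ m) -sum_bimon mulr_sumr mulr_suml.
transitivity (\sum_(k < m.+2) (k%:R * 'C(m.+1, k)%:R * bimon m.+1 k y) -
    \sum_(k < m.+2) ((m.+1 - k)%:R * 'C(m.+1, k)%:R * bimon m.+1 k y)).
  rewrite -sumrB; apply: eq_bigr => k _.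
  by rewrite natrB ?leq_ord//; ring.
rewrite big_ord_recl [X in _ - X]big_ord_recr /= subnn !mul0r add0r addr0.
rewrite -sumrB; apply: eq_bigr => k _; rewrite /bump /= add1n.
rewrite -!natrM -mul_bin_diag -mul_bin_down /= !natrM.
rewrite /bimon subSS subSn ?leq_ord// !exprS.
by ring.
Qed.

End bimon.

Section weights.
Variable R : realType.

Definition Dcst (M : nat) : R := M.+1%:R / (2 ^+ M.+2 * Num.sqrt pi).

Lemma sqrt_pi_gt0 : 0 < Num.sqrt pi :> R.
Proof. by rewrite sqrtr_gt0 pi_gt0. Qed.

(** Parametrizing by k = 2t treats r_j and the half-integer shift r_{j+1/2} at once: all Gamma
    values are factorials. *)
Lemma rnormV M k (t : R) : (k <= M)%N -> 2 * t = k%:R ->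
  (rnorm M.+1 t)^-1 = (M%:R - 2 * k%:R) * Dcst M * 'C(M, k)%:R.
Proof.
move=> kM tk; rewrite /rnorm.
have -> : 4 * t = 2 * k%:R by rewrite -tk; ring.
have -> : M.+1%:R - 1 - 2 * k%:R = M%:R - 2 * k%:R :> R by rewrite -natr1; ring.
rewrite tk Gamma_fact.
have -> : M.+1%:R - k%:R = (M - k)%:R + 1 :> R by rewrite natrB// -natr1; ring.
rewrite !Gamma_fact factS -(bin_fact kM) !natrM.
(* At k = M/2 division by zero makes [rnorm] and its inverse 0, in agreement with the factor M -
   2k. *)
have [e|e] := eqVneq (M%:R - 2 * k%:R : R) 0.
  by rewrite e invr0 mulr0 !mul0r invr0.
rewrite /Dcst; field.
have s0 : Num.sqrt pi != 0 :> R by rewrite gt_eqF// sqrt_pi_gt0.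
rewrite s0 e [1 + _]addrC natr1 expf_neq0 ?pnatr_eq0//=.
by rewrite -!lt0n !fact_gt0 bin_gt0 kM.
Qed.

End weights.

(** * The functions a_j and b_j on monomials *)

Section coefficients.
Variable R : realType.
Implicit Types (r t : R) (M k : nat).

(* The square root of [r%:C * cis t] with argument [t / 2]. *)
Definition half r t : R[i] := (Num.sqrt r)%:C * cis (t / 2).

Definition Tcst M r : R :=
  Num.sqrt ((Num.sqrt pi)^-1 * tail M.+1 (`|r^-1 - r| / 2)).

Lemma rC_neq0 r : r != 0 -> r%:C != 0 :> R[i].
Proof. by move=> r0; rewrite fmorph_eq0. Qed.

Lemma half_neq0 r t : 0 < r -> half r t != 0.
Proof. by move=> r0; rewrite mulf_neq0 ?cis_neq0// rC_neq0// gt_eqF// sqrtr_gt0. Qed.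

Lemma half_sqr r t : 0 < r -> half r t ^+ 2 = r%:C * cis t.
Proof.
move=> r0; rewrite exprMn -rmorphXn/= sqr_sqrtr ?ltW// cisX.
by congr (_ * cis _); field.
Qed.

Lemma half1 t : half 1 t = cis (t / 2).
Proof. by rewrite /half sqrtr1 mul1r. Qed.

Lemma tau_polar M r t : 0 < r -> 0 <= t < 2 * pi ->
  tau M.+1 (r%:C * cis t) = (half r t)^-1 ^+ M * (Tcst M r)%:C.
Proof.
move=> r0 ht; rewrite /tau normc_polar ?ltW// argc_polar// /Tcst.
congr (_ * _); rewrite invfM exprMn; congr (_ * _).
  rewrite -fmorphV -rmorphXn /=; congr (_%:C).
  have -> : - ((M.+1%:R - 1) / 2) = - (2^-1 * M%:R) :> R by rewrite -natr1; field.
  by rewrite powRN powRrM powR12_sqrt ?ltW// powR_mulrn ?sqrtr_ge0// exprVn.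
rewrite -cisN cisX; by congr cis; rewrite -natr1; field.
Qed.

Lemma tau_polar_Xn M k r t : 0 < r -> 0 <= t < 2 * pi -> (k <= M)%N ->
  tau M.+1 (r%:C * cis t) * (r%:C * cis t) ^+ k =
  (Tcst M r)%:C * bimon M k (half r t).
Proof.
move=> r0 ht kM; rewrite tau_polar// -half_sqr//.
have y0 := half_neq0 t r0; set y := half r t in y0 *.
have yk : y ^+ k != 0 by rewrite expf_neq0.
have -> : y^-1 ^+ M = y^-1 ^+ (M - k) * y^-1 ^+ k by rewrite -exprD subnK.
rewrite /bimon -exprM mul2n -addnn exprD [y^-1 ^+ k]exprVn.
by field.
Qed.

Lemma Tcst_inv M r : Tcst M r^-1 = Tcst M r.
Proof. by rewrite /Tcst invrK distrC. Qed.

Definition weight (x : R[i]) : R[i] :=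
  if normc x < 1 then ((normc x)^-1)%:C else sqrtc (- 'i%C / 2).

Lemma acoefE N (q : {poly R[i]}) x : acoef N q x = weight x * tau N x * q.[x].
Proof. by rewrite /acoef /weight; case: ifP. Qed.

Lemma weight_disk r t : 0 < r < 1 -> weight (r%:C * cis t) = (r^-1)%:C.
Proof. by move=> /andP[r0 r1]; rewrite /weight normc_polar ?ltW// r1. Qed.

Lemma weight_circle t : weight (cis t) = sqrtc (- 'i%C / 2).
Proof. by rewrite /weight normc_cis ltxx. Qed.

Lemma acoef_Xn M k r t : 0 < r -> 0 <= t < 2 * pi -> (k <= M)%N ->
  acoef M.+1 'X^k (r%:C * cis t) =
  weight (r%:C * cis t) * (Tcst M r)%:C * bimon M k (half r t).
Proof. by move=> r0 ht kM; rewrite acoefE hornerXn -mulrA tau_polar_Xn// mulrA. Qed.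

Lemma bcoef_disk_Xn M k r t : 0 < r < 1 -> 0 <= t < 2 * pi -> (k <= M)%N ->
  bcoef M.+1 'X^k (r%:C * cis t) = (r^-1 * Tcst M r)%:C * bimon M k (half r^-1 t).
Proof.
move=> /andP[r0 r1] ht kM; rewrite /bcoef normc_polar ?ltW// r1.
rewrite inv_conjc_polar hornerXn -mulrA tau_polar_Xn ?invr_gt0// Tcst_inv.
by rewrite mulrA rmorphM.
Qed.

Lemma tau_cis_Xn M k t : 0 <= t < 2 * pi -> (k <= M)%N ->
  tau M.+1 (cis t) * (cis t) ^+ k =
  (Tcst M 1)%:C * cis ((k%:R - M%:R / 2) * t).
Proof.
move=> ht kM; have := tau_polar_Xn ltr01 ht kM; rewrite mul1r => ->.
rewrite half1 /bimon -cisN !cisX -cisD natrB//; congr (_ * cis _); by field.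
Qed.

Lemma cis_2pi_half M k : (k <= M)%N ->
  cis ((k%:R - M%:R / 2) * (2 * pi)) = (-1) ^+ M :> R[i].
Proof.
move=> kM.
have c2 : cis (2 * pi) = 1 :> R[i].
  by rewrite /cis mulrC mulr_natr cos2pi sin2pi.
have cp : cis (- pi) = -1 :> R[i].
  by rewrite /cis cosN sinN cospi sinpi oppr0 -[RHS]/(-1 +i* (- 0)) oppr0.
have -> : (k%:R - M%:R / 2) * (2 * pi) = k%:R * (2 * pi) + M%:R * (- pi) :> R.
  by field.
by rewrite cisD -(cisX (2 * pi)) -(cisX (- pi)) c2 cp expr1n mul1r.
Qed.

(** Integration divides by k - M/2, so the formula is multiplied by 2k - M to include k = M/2, where
    [bimon] is 1, M is even and both sides vanish. The part 1 + (-1)^M comes from the endpoints 0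
    and 2 pi, and the [bimon] term from the jump at t. *)
Lemma bcoef_circle_Xn M k t : 0 <= t < 2 * pi -> (k <= M)%N ->
  (2 * k%:R - M%:R) * bcoef M.+1 'X^k (cis t) =
  - 2 * 'i%C * sqrtc (- 'i%C / 2) * (Tcst M 1)%:C *
    (1 + (-1) ^+ M - 2 * bimon M k (cis (t / 2))).
Proof.
move=> ht kM; rewrite /bcoef normc_cis ltxx argc_cis//.
have bE : bimon M k (cis (t / 2)) = cis ((k%:R - M%:R / 2) * t).
  by rewrite /bimon -cisN !cisX -cisD natrB//; congr (cis _); field.
have [e|ne] := eqVneq (k%:R - M%:R / 2 : R) 0.
  have e2 : 2 * k%:R - M%:R = 0 :> R[i].
    have : (2 * k%:R - M%:R : R)%:C = 0 :> R[i].
      by rewrite (_ : _ - _ = 2 * (k%:R - M%:R / 2)); [rewrite e mulr0|field].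
    by rewrite rmorphB rmorphM !rmorph_nat.
  have := cis_2pi_half kM; rewrite e mul0r cis0 => <-.
  rewrite bE e mul0r cis0 e2 mul0r; ring.
rewrite (@circle_integral_cis_sg R _ (Tcst M 1) (k%:R - M%:R / 2) t ne).
- rewrite cis_2pi_half// bE.
  have -> : (k%:R - M%:R / 2)%:C = (2 * k%:R - M%:R) / 2 :> R[i].
    by rewrite rmorphB rmorphM fmorphV !rmorph_nat; field.
  have ne2 : 2 * k%:R - M%:R != 0 :> R[i].
    apply: contra_neq ne => e2; apply: (fmorph_inj (real_complex R)).
    rewrite rmorphB rmorphM fmorphV !rmorph_nat rmorph0.
    by apply: (mulfI (_ : 2 != 0 :> R[i])); rewrite // mulr0 -e2; field.
  have i0 : 'i%C != 0 :> R[i] by rewrite eq_complex /= oner_eq0 andbF.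
  have i2 := sqr_i R.
  have -> : - 2 * 'i%C = 2 / 'i%C :> R[i].
    by apply: (mulIf i0); rewrite divfK// -mulrA -expr2 i2; ring.
  by field; rewrite i0 ne2.
- by case/andP: ht => -> /ltW.
- by move=> x hx; rewrite hornerXn tau_cis_Xn.
Qed.

End coefficients.

(** * The skew product and the last polynomial *)

Section polar.
Variable R : realType.

Lemma polarP (w : R[i]) : w != 0 ->
  exists r t, [/\ 0 < r, 0 <= t < 2 * pi & w = r%:C * cis t].
Proof.
move=> w0; pose r := normc w.
have r0 : 0 < r.
  rewrite lt_neqAle eq_sym; apply/andP; split; last first.
    by rewrite /r; case: (w) => a b; exact: sqrtr_ge0.
  by apply: contra_neq w0; exact: Normc.eq0_normc.
have wE : w = r%:C * (w / r%:C) by rewrite mulrC divfK// rC_neq0// gt_eqF.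
have : normc (w / r%:C) = 1.
  by rewrite Normc.normcM Normc.normcV -[r%:C]mulr1 -(cis0 R) normc_polar ?ltW// divff// gt_eqF.
case: (w / r%:C) wE => a b wE /= n1.
have {n1} ab : a ^+ 2 + b ^+ 2 = 1.
  by rewrite -[LHS]sqr_sqrtr ?addr_ge0 ?sqr_ge0// n1 expr1n.
have a1 : -1 <= a <= 1 by apply/andP; split; nra.
have ca : cos (acos a) = a by apply: acosK; rewrite in_itv.
have sa : sin (acos a) = `|b|.
  by rewrite sin_acos// (_ : 1 - a ^+ 2 = b ^+ 2) ?sqrtr_sqr//; lra.
have ac0 := acos_ge0 a1; have acpi := acos_lepi a1.
have p0 := pi_gt0 R.
have [b0|b0] := leP 0 b.
  exists r, (acos a); split => //; first by rewrite ac0 /=; lra.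
  by rewrite {1}wE /cis ca sa ger0_norm.
exists r, (2 * pi - acos a); split => //.
  have : acos a != 0.
    apply: contraTneq b0 => e; move: sa; rewrite e sin0 => /esym/eqP.
    by rewrite normr_eq0 => /eqP ->; rewrite ltxx.
  by move=> ne; apply/andP; split; [lra|have : 0 < acos a by rewrite lt_neqAle eq_sym ne]; lra.
rewrite {1}wE /cis mulr_natl cosB sinB cos2pi sin2pi ca sa ltr0_norm//.
by congr (_ * (_ +i* _)); ring.
Qed.

End polar.

Section skew.
Variable R : realType.
Implicit Types (M k h : nat).

(** Reflection in the circle keeps the argument, so the two half-angle phases combine into a
    full-angle one and the dependence on the branch of [argc] disappears. *)
Lemma tau_mul_tau_invJ M (w : R[i]) : w != 0 ->
  tau M.+1 w * tau M.+1 (conjc w)^-1 =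
  (Tcst M (normc w) ^+ 2)%:C * ((normc w)%:C / w) ^+ M.
Proof.
move=> /polarP [r [t [r0 ht ->]]].
rewrite inv_conjc_polar !tau_polar ?invr_gt0// Tcst_inv normc_polar ?ltW//.
have rC : r%:C != 0 :> R[i] by rewrite rC_neq0// gt_eqF.
have hh : half r t * half r^-1 t = cis t.
  rewrite mulrACA -rmorphM /= -sqrtrM ?ltW// divff ?gt_eqF// sqrtr1 mul1r -cisD.
  by congr cis; field.
rewrite rmorphXn mulrACA -exprMn -invfM hh [RHS]mulrC expr2; congr (_ ^+ _ * _).
by field; rewrite cis_neq0 rC.
Qed.

Lemma disk_integral_skew M k h : M = (2 * h)%N -> k != h ->
  disk_integral (fun w : R[i] =>
      tau M.+1 w * tau M.+1 (conjc w)^-1 / ((normc w) ^+ 2)%:C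
      * (('X^k).[w] * ('X^h).[(conjc w)^-1] - ('X^h).[w] * ('X^k).[(conjc w)^-1])) = 0.
Proof.
move=> Mh kh; pose d : R := k%:R - h%:R.
have d0 : d != 0 by rewrite subr_eq0 eqr_nat.
have d1 : 1 <= `|d|.
  rewrite /d; have [hk|hk] := ltnP h k.
    by rewrite -natrB 1?ltnW// normr_nat ler1n subn_gt0.
  by rewrite distrC -natrB// normr_nat ler1n subn_gt0 ltn_neqAle kh.
(* Rotation by [al] multiplies the integrand by the phase of angle (k + h - M) al = d al, a quarter
   turn. As |d| >= 1, the angle al / 2 stays within pi / 4 of 0, where the cosine is nonzero. *)
pose al : R := pi / (2 * d).
have cal : cis (d * al) = 'i%C :> R[i].
  rewrite (_ : d * al = pi / 2); last by rewrite /al; field.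
  by rewrite /cis cos_pihalf sin_pihalf.
apply: (@disk_integral_eq0 R _ al).
  rewrite gt_eqF// cos_gt0_pihalf// -ltr_norml.
  have dp : 0 < `|d| by exact: lt_le_trans d1.
  have -> : al / 2 = pi / 4 / d by rewrite /al; field.
  have p0 := pi_gt0 R.
  rewrite normrM normfV ger0_norm ?divr_ge0 ?pi_ge0// ltr_pdivrMr//; nra.
(* At the origin [normc w] is 0 and division by zero makes the integrand 0. *)
move=> w; have [->|w0] := eqVneq w 0.
  by rewrite !mulr0 Normc.normc0 expr0n /= invr0 !mulr0 !mul0r mulr0.
have cw0 : cis al * w != 0 by rewrite mulf_neq0// cis_neq0.
rewrite !tau_mul_tau_invJ// Normc.normcM normc_cis mul1r.
have -> : (conjc (cis al * w))^-1 = cis al * (conjc w)^-1.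
  have -> : conjc (cis al * w) = cis (- al) * conjc w.
    by case: (w) => a b; rewrite /cis cosN sinN /=; congr (_ +i* _); ring.
  by rewrite cisN invfM invrK.
rewrite !hornerXn.
have c0 := cis_neq0 al; set c := cis al in cal c0 *.
set v := (conjc w)^-1; set T := (Tcst M _ ^+ 2)%:C; set n := ((normc w ^+ 2)%:C).
have cE : 'i%C * c ^+ M = c ^+ k * c ^+ h.
  by rewrite -cal /c !cisX -!cisD Mh; congr cis; rewrite natrM /d; ring.
have -> : (normc w)%:C / (c * w) = c^-1 * ((normc w)%:C / w) by rewrite invfM mulrCA.
set z := (normc w)%:C / w.
have cM : c ^+ M != 0 by rewrite expf_neq0.
rewrite [(c^-1 * z) ^+ M]exprMn exprVn !exprMn.
have -> : 'i%C = c ^+ k * c ^+ h / c ^+ M by rewrite -cE mulfK.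
ring.
Qed.

Lemma skew_prod_Xn M k h : M = (2 * h)%N -> (k <= M)%N -> k != h ->
  skew_prod M.+1 'X^k 'X^h =
  (4 * pi * Tcst M 1 ^+ 2)%:C / (2 * k%:R - M%:R) :> R[i].
Proof.
move=> Mh kM kh; rewrite /skew_prod disk_integral_skew// addr0.
have hM : (h <= M)%N by rewrite Mh leq_pmull.
have m0 : k%:R - M%:R / 2 != 0 :> R.
  rewrite Mh natrM (_ : _ - _ = k%:R - h%:R :> R); last by field.
  by rewrite subr_eq0 eqr_nat.
rewrite (@circle_integral_cis_affine R _ (Tcst M 1 ^+ 2) _ m0).
- have -> : 2 * k%:R - M%:R = 2 * (k%:R - M%:R / 2)%:C :> R[i].
    by rewrite rmorphB rmorphM fmorphV !rmorph_nat; field.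
  have mC := rC_neq0 m0; have i2 := sqr_i R.
  set m := k%:R - _ in m0 mC *; clearbody m.
  transitivity (- ('i%C ^+ 2) * ((Tcst M 1 ^+ 2)%:C * (4 * pi / m)%:C) / 2 : R[i]).
    by field.
  rewrite i2 !rmorphM fmorphV /=.
  by field; rewrite mC.
- by rewrite cis_2pi_half// Mh exprM sqrrN !expr1n.
(* On the circle tau(x) x^h is the constant [Tcst M 1] because h = M/2, so the inner integral only
   sees the sign and gives 2 pi - 2t. *)
move=> t ht; have ht' : 0 <= t <= 2 * pi by case/andP: ht => -> /ltW.
rewrite (@circle_integral_sg R _ ((Tcst M 1)%:C * cis t ^+ k) t ht').
  by rewrite mulrA mulrCA tau_cis_Xn// rmorphXn /=; ring.
move=> x hx; rewrite !hornerXn.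
have := tau_cis_Xn hx hM; rewrite (_ : h%:R - M%:R / 2 = 0 :> R).
  by rewrite mul0r cis0 mulr1 => <-; ring.
by rewrite Mh natrM; field.
Qed.

End skew.

(** * The kernel as a single sum over exponents, and the last polynomial *)

Section kernel_sums.
Variable R : realType.
Implicit Types (M k h l : nat) (x y : R[i]).

Lemma realCM (a b : R) : (a * b)%:C = a%:C * b%:C :> R[i].
Proof. exact: rmorphM. Qed.

Lemma realCB (a b : R) : (a - b)%:C = a%:C - b%:C :> R[i].
Proof. exact: rmorphB. Qed.

Lemma realCV (a : R) : (a^-1)%:C = (a%:C)^-1 :> R[i].
Proof. exact: fmorphV. Qed.

Lemma realCX (a : R) (n : nat) : (a ^+ n)%:C = a%:C ^+ n :> R[i].
Proof. exact: rmorphXn. Qed.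

Lemma realC_nat (n : nat) : (n%:R : R)%:C = n%:R :> R[i].
Proof. exact: rmorph_nat. Qed.

Lemma weightC M k (D : R) :
  ((M%:R - 2 * k%:R) * D * 'C(M, k)%:R)%:C =
  (M%:R - 2 * k%:R) * D%:C * 'C(M, k)%:R :> R[i].
Proof.
by rewrite !realCM realCB realCM !realC_nat.
Qed.

Definition kernel_term M x y k : R[i] :=
  ((M%:R - 2 * k%:R) * Dcst R M * 'C(M, k)%:R)%:C *
  (acoef M.+1 'X^k x * bcoef M.+1 'X^(M - k) y).

(** The factor M - 2k is antisymmetric under k |-> M - k while the binomial is symmetric, which
    turns the skew difference into a sum of two terms of the same shape. *)
Lemma kernel_term_pair M k (t : R) x y : (k <= M)%N -> 2 * t = k%:R ->
  ((rnorm M.+1 t)^-1)%:C *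
    (acoef M.+1 'X^k x * bcoef M.+1 'X^(M - k) y -
     acoef M.+1 'X^(M - k) x * bcoef M.+1 'X^k y) =
  kernel_term M x y k + kernel_term M x y (M - k).
Proof.
move=> kM tk; rewrite (rnormV kM tk) /kernel_term subKn// bin_sub// natrB//.
have -> : (M%:R - 2 * (M%:R - k%:R)) * Dcst R M * 'C(M, k)%:R =
    - ((M%:R - 2 * k%:R) * Dcst R M * 'C(M, k)%:R) by ring.
by rewrite rmorphN; ring.
Qed.

Lemma S_even_sum M x y : odd M ->
  S_even M.+1 x y = \sum_(k < M.+1) kernel_term M x y k.
Proof.
move=> oM; pose n := M.+1./2.
have nM : (M.+1 = 2 * n)%N by rewrite mul2n /n -[LHS]odd_double_half /= oM.
transitivity (\sum_(l < n) (kernel_term M x y (2 * l) +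
    kernel_term M x y (2 * n - 1 - 2 * l))); last by rewrite sum_pairs_even -nM.
apply: eq_bigr => l _.
have lM : (2 * l <= M)%N by have := ltn_ord l; lia.
have -> : q_even M.+1 (2 * l) = 'X^(2 * l) :> {poly R[i]}.
  rewrite /q_even (_ : odd _ = false); last by lia.
  by rewrite (_ : (2 * l)./2 = l); last by lia.
have -> : q_even M.+1 (2 * l + 1) = 'X^(M - 2 * l) :> {poly R[i]}.
  rewrite /q_even (_ : odd _ = true); last by lia.
  by rewrite (_ : (2 * l + 1)./2 = l) ?subn1; last by lia.
rewrite (kernel_term_pair _ _ lM); last by rewrite natrM.
by rewrite (_ : (2 * n - 1 - 2 * l = M - 2 * l)%N)//; lia.
Qed.

(** The exponent of q_{2l} for N = 2h + 1; that of q_{2l+1} is its complement to 2h. The switch at h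
    skips the exponent h, which is left to q_{N-1}. *)
Definition odd_index h l := if (2 * l < h)%N then (2 * l)%N else (2 * l + 1)%N.

Lemma q_odd_even_index h l : q_odd (2 * h).+1 (2 * l) = 'X^(odd_index h l) :> {poly R[i]}.
Proof.
rewrite /q_odd /odd_index (_ : odd _ = false); last by lia.
rewrite (_ : ((2 * h).+1 - 1)./2 = h); last by lia.
rewrite (_ : (2 * l)./2 = l); last by lia.
by case: ifP.
Qed.

Lemma q_odd_odd_index h l : q_odd (2 * h).+1 (2 * l + 1) =
  'X^(2 * h - odd_index h l) :> {poly R[i]}.
Proof.
rewrite /q_odd /odd_index (_ : odd _ = true); last by lia.
rewrite (_ : ((2 * h).+1 - 1)./2 = h); last by lia.
rewrite (_ : (2 * l + 1)./2 = l); last by lia.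
by case: ifP => _; congr ('X^_); lia.
Qed.

Lemma R_odd_index h l : exists2 t : R, 2 * t = (odd_index h l)%:R &
  R_odd (2 * h).+1 l = rnorm (2 * h).+1 t.
Proof.
rewrite /R_odd /odd_index (_ : ((2 * h).+1 - 1)./2 = h); last by lia.
case: ifP => _; first by exists l%:R; rewrite ?natrM.
by exists (l%:R + 1 / 2); rewrite // natrD natrM; field.
Qed.

Lemma odd_index_le h l : (l < h)%N -> (odd_index h l <= 2 * h)%N.
Proof. by rewrite /odd_index; case: ifP; lia. Qed.

Lemma odd_index_neq h l : (l < h)%N -> odd_index h l != h.
Proof. by rewrite /odd_index; case: ifP; lia. Qed.

Lemma S_odd_sum h x y :
  S_odd (2 * h).+1 x y =
  \sum_(k < (2 * h).+1) kernel_term (2 * h) x y k + kappa (2 * h).+1 x y.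
Proof.
rewrite /S_odd (_ : ((2 * h).+1 - 1)./2 = h); last by lia.
congr (_ + _).
transitivity (\sum_(k < (2 * h).+1 | k != h :> nat) kernel_term (2 * h) x y k).
  rewrite -sum_pairs_odd; apply: eq_bigr => l _.
  have [t ht ->] := R_odd_index h l.
  rewrite q_odd_even_index q_odd_odd_index.
  by rewrite (kernel_term_pair _ _ _ ht)// odd_index_le.
rewrite [RHS](bigID (fun k : 'I__ => k != h :> nat)) /= [X in _ + X]big1 ?addr0//.
move=> k; rewrite negbK => /eqP ->.
by rewrite /kernel_term natrM subrr !mul0r.
Qed.

(** The skew product contributes 1 / (2k - M) and 1 / R_j contributes (M - 2k) C(M, k), so up to one
    common constant the coefficients are binomial. *)
Lemma q_odd_last_closed h :
  q_odd_last (2 * h).+1 =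
  (4 * pi * Tcst (2 * h) 1 ^+ 2 * Dcst R (2 * h))%:C *: (1 + 'X) ^+ (2 * h).
Proof.
set M := (2 * h)%N; set A : R := 4 * pi * _ * _.
(* The coefficient of x^h is prescribed to be 1 and does not come from a skew product; the common
   constant [A] has to fit it. *)
have AC : A * 'C(M, h)%:R = 1.
  have s0 := sqrt_pi_gt0 R.
  have spi : Num.sqrt pi ^+ 2 = pi :> R by rewrite sqr_sqrtr// pi_ge0.
  rewrite /A /Tcst invr1 subrr normr0 mul0r sqr_sqrtr; last first.
    by rewrite mulr_ge0 ?invr_ge0 ?sqrtr_ge0// Rintegral_ge0// => t _; rewrite invr_ge0 powR_ge0.
  have := tail0_central_binomial R h; rewrite -mul2n -/M => e.
  rewrite /Dcst; set s := Num.sqrt pi in s0 spi *; clearbody s; rewrite -spi.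
  transitivity (4 * (tail M.+1 0 * M.+1%:R * 'C(M, h)%:R) / 2 ^+ M.+2 : R).
    by field; rewrite expf_neq0 ?pnatr_eq0 ?gt_eqF.
  rewrite e !exprS; field.
  by rewrite expf_neq0 ?pnatr_eq0.
rewrite /q_odd_last (_ : ((2 * h).+1 - 1)./2 = h); last by lia.
transitivity ('X^h + \sum_(k < M.+1 | k != h :> nat) (A * 'C(M, k)%:R)%:C *: 'X^k : {poly R[i]}).
  congr (_ + _); rewrite -(sum_pairs_odd (fun k => (A * 'C(M, k)%:R)%:C *: 'X^k)).
  apply: eq_bigr => l _; have lh := ltn_ord l.
  have [t ht ->] := R_odd_index h l; rewrite q_odd_even_index q_odd_odd_index -/M.
  rewrite -/(odd_index h l); have kM := odd_index_le lh; have kh := odd_index_neq lh.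
  set k := odd_index h l in ht kM kh *; rewrite -/M in kM *.
  rewrite !(skew_prod_Xn R (erefl M)) ?leq_subr//; last by apply: contra_neq kh; rewrite /M; lia.
  rewrite (rnormV kM ht) bin_sub// scalerBr !scalerA natrB//.
  have ne : 2 * k%:R - M%:R != 0 :> R.
    by rewrite subr_eq0 -natrM eqr_nat /M eqn_pmul2l.
  have neC : 2 * k%:R - M%:R != 0 :> R[i].
    by have := rC_neq0 ne; rewrite rmorphB rmorphM !rmorph_nat.
  have AE : (A * 'C(M, k)%:R)%:C =
      (4 * pi * Tcst M 1 ^+ 2)%:C * (Dcst R M)%:C * 'C(M, k)%:R :> R[i].
    by rewrite /A realCM realC_nat [X in X * _]realCM.
  rewrite -scaleNr; congr (_ *: _ + _ *: _).
    rewrite (_ : 2 * (M%:R - k%:R) - M%:R = - (2 * k%:R - M%:R)); last by ring.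
    by rewrite weightC AE; field; rewrite neC.
  by rewrite weightC AE; field.
rewrite exprDn scaler_sumr [RHS](bigD1 (Ordinal (_ : h < M.+1)%N)) /=; last first.
  by rewrite ltnS /M leq_pmull.
move=> hM; congr (_ + _).
  by rewrite expr1n mul1r -scaler_nat scalerA -realC_nat -realCM AC scale1r.
apply: eq_big => [k|k _]; first by rewrite -val_eqE.
by rewrite expr1n mul1r realCM realC_nat -scalerA scaler_nat.
by rewrite ltnS /M leq_pmull.
Qed.

End kernel_sums.

(** * Closed forms of the kernel *)

Section closed_forms.
Variable R : realType.
Implicit Types (M k h : nat) (r t s : R).

Lemma kernel_sum_disk M r t p s : 0 < r -> 0 <= t < 2 * pi ->
  0 < p < 1 -> 0 <= s < 2 * pi ->
  let x := r%:C * cis t in let v := half r t / half p^-1 s in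
  \sum_(k < M.+1) kernel_term M x (p%:C * cis s) k =
  - (Dcst R M)%:C * (weight x * (Tcst M r)%:C) * (p^-1 * Tcst M p)%:C *
    (M%:R * (v + v^-1) ^ (M.+1%:Z - 2) * (v - v^-1)).
Proof.
move=> r0 ht hp hs x v; rewrite -sum_bimon_deriv mulr_sumr.
apply: eq_bigr => k _; have kM : (k <= M)%N := leq_ord k.
rewrite /kernel_term /x acoef_Xn// bcoef_disk_Xn ?leq_subr// bimonV// /v (bimonM M k (half r t)).
rewrite weightC.
move: (weight _) (Tcst M r)%:C (Dcst R M)%:C (p^-1 * Tcst M p)%:C
  (bimon M k (half r t)) (bimon M k (half p^-1 s)^-1) => W T D B E1 E2.
by ring.
Qed.

(** The integral defining b absorbs the factor 2k - M, so the plain binomial formula applies, with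
    no derivative. The endpoint part depends on x alone and survives only for even M. *)
Lemma kernel_sum_circle M r t s : 0 < r -> 0 <= t < 2 * pi -> 0 <= s < 2 * pi ->
  let x := r%:C * cis t in
  let y := half r t in let v := half r t / half 1 s in
  \sum_(k < M.+1) kernel_term M x (cis s) k =
  - 2 * 'i%C * sqrtc (- 'i%C / 2) * (Dcst R M * Tcst M 1)%:C *
    (weight x * (Tcst M r)%:C) *
    ((1 + (-1) ^+ M) * (y + y^-1) ^+ M - 2 * (v + v^-1) ^+ M).
Proof.
move=> r0 ht hs x y v; rewrite -!sum_bimon !mulr_sumr -sumrB mulr_sumr.
apply: eq_bigr => k _; have kM : (k <= M)%N := leq_ord k.
rewrite /kernel_term /x acoef_Xn// -/y.
have E := @bcoef_circle_Xn R M (M - k) s hs (leq_subr _ _).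
rewrite bimonV// -half1 natrB// in E.
transitivity ((Dcst R M)%:C * 'C(M, k)%:R *
    (weight x * (Tcst M r)%:C * bimon M k y) *
    ((2 * (M%:R - k%:R) - M%:R) * bcoef M.+1 'X^(M - k) (cis s))).
  rewrite weightC; move: (weight _) (Tcst M r)%:C (Dcst R M)%:C (bimon M k y) => W T D E1.
  by move: (bcoef _ _ _) => B; ring.
rewrite E /v (bimonM M k (half r t)) -/y [(Dcst R M * _)%:C]realCM.
move: (weight _) (Tcst M r)%:C (Dcst R M)%:C (Tcst M 1)%:C (sqrtc _)
  (bimon M k y) (bimon M k (half 1 s)^-1) => W T D T1 S0 E1 E2.
by ring.
Qed.

Lemma nuE M : nu M.+1 = 2 * pi * Tcst M 1 :> R.
Proof.
rewrite /nu /Tcst invr1 subrr normr0 mul0r tail0_Gamma.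
set g := Gamma _ / Gamma _; clearbody g.
have s0 := sqrt_pi_gt0 R.
have -> : (Num.sqrt pi)^-1 * (Num.sqrt pi / 2 * g) = 2^-1 * g :> R.
  by field; rewrite gt_eqF.
rewrite sqrtrM ?invr_ge0// sqrtrV//.
have -> : 2 * pi = Num.sqrt 2 * Num.sqrt 2 * pi :> R by rewrite -expr2 sqr_sqrtr.
by field; rewrite gt_eqF// sqrtr_gt0.
Qed.

Lemma tail_ge0 M (x : R) : 0 <= tail M x.
Proof. by apply: Rintegral_ge0 => t _; rewrite invr_ge0 powR_ge0. Qed.

Lemma Tcst1_sqr M :
  Tcst M 1 ^+ 2 = Gamma ((M.+1%:R + 1) / 2) / Gamma (M.+1%:R / 2 + 1) / 2 :> R.
Proof.
have s0 := sqrt_pi_gt0 R.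
rewrite /Tcst invr1 subrr normr0 mul0r sqr_sqrtr; last first.
  by rewrite mulr_ge0 ?invr_ge0 ?sqrtr_ge0 ?tail_ge0.
by rewrite tail0_Gamma; set g := Gamma _ / Gamma _; field; rewrite gt_eqF.
Qed.

Lemma Tcst1_gt0 M : 0 < Tcst M 1 :> R.
Proof.
rewrite lt_neqAle sqrtr_ge0 andbT eq_sym -sqrf_eq0 Tcst1_sqr.
have G1 := Gamma_half_nat_gt0 R M.+1.
have := Gamma_half_nat_gt0 R M.+2.
rewrite (_ : (M.+2%:R + 1) / 2 = M.+1%:R / 2 + 1); last by rewrite -natr1; field.
by move=> G2; rewrite gt_eqF// !divr_gt0.
Qed.

Lemma sqrtc_Ni2_sqr : sqrtc (- 'i%C / 2) ^+ 2 = - 'i%C / 2 :> R[i].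
Proof. exact: sqr_sqrtc. Qed.

Lemma kappa_circle h r t s : 0 < r -> 0 <= t < 2 * pi ->
  let M := (2 * h)%N in let x := r%:C * cis t in let y := half r t in
  kappa M.+1 x (cis s) =
  4 * 'i%C * sqrtc (- 'i%C / 2) * (Dcst R M * Tcst M 1)%:C *
    (weight x * (Tcst M r)%:C) * (y + y^-1) ^+ M.
Proof.
move=> r0 ht M x y; rewrite /kappa normc_cis ltxx acoefE q_odd_last_closed -/M.
have y0 : y != 0 by exact: half_neq0.
(* Since x = y^2, the factor y^M of (1 + x)^M cancels the y^(-M) of tau(x). *)
have xE : 1 + x = y * (y + y^-1) by rewrite /x -half_sqr// -/y; field.
rewrite hornerZ horner_exp hornerD hornerX hornerC xE /x tau_polar// -/x -/y.
rewrite exprMn nuE.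
have i0 : 'i%C != 0 :> R[i] by rewrite eq_complex /= oner_eq0 andbF.
have T0 : (Tcst M 1)%:C != 0 :> R[i] by rewrite rC_neq0// gt_eqF ?Tcst1_gt0.
have p0 : pi%:C != 0 :> R[i] by rewrite rC_neq0// gt_eqF ?pi_gt0.
have s2 := sqrtc_Ni2_sqr; set s0 := sqrtc _ in s2 *.
have s00 : s0 != 0.
  by rewrite -sqrf_eq0 s2 mulf_neq0 ?oppr_eq0 ?invr_eq0 ?pnatr_eq0.
have i2 := sqr_i R.
(* This restates s0^2 = -i/2 and moves the root in the denominator of [kappa] to the numerator, to
   match the sum. *)
have e : s0^-1 = 2 * 'i%C * s0.
  apply: (mulfI s00); rewrite mulfV//.
  transitivity (- 'i%C ^+ 2 : R[i]); first by rewrite i2 opprK.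
  transitivity (2 * 'i%C * s0 ^+ 2); last by ring.
  by rewrite s2; field.
rewrite [(s0 * _)^-1]invfM e exprVn.
move: (Dcst R M) (Tcst M 1) (weight x) (Tcst M r)%:C T0 (expf_neq0 M y0) =>
  D T1 W T T0.
move: (y ^+ M) ((y + y^-1) ^+ M) => Y P Y0.
rewrite !realCM !realC_nat.
move: (pi%:C) (T1%:C) (D%:C) s0 p0 T0 {s2 s00 e} => Pi T1C DC s0 p0 T0.
by field; rewrite T0 p0 Y0.
Qed.

Lemma S_kernel_circle M r t s : 0 < r -> 0 <= t < 2 * pi -> 0 <= s < 2 * pi ->
  let x := r%:C * cis t in let v := half r t / half 1 s in
  S_kernel M.+1 x (cis s) =
  4 * 'i%C * sqrtc (- 'i%C / 2) * (Dcst R M * Tcst M 1)%:C *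
    (weight x * (Tcst M r)%:C) * (v + v^-1) ^+ M.
Proof.
move=> r0 ht hs x v; rewrite /S_kernel [odd M.+1]/=; case: ifPn => oM.
  have [h Mh] : exists h, M = (2 * h)%N by exists M./2; lia.
  rewrite Mh S_odd_sum kernel_sum_circle// kappa_circle// -/x -/v.
  have -> : (-1) ^+ (2 * h) = 1 :> R[i] by rewrite exprM sqrrN !expr1n.
  by ring.
rewrite S_even_sum; last by rewrite -[odd M]negbK.
rewrite kernel_sum_circle// -/x -/v.
by rewrite -signr_odd (negbNE oM) expr1; ring.
Qed.

Lemma S_kernel_disk M r t p s : 0 < r -> 0 <= t < 2 * pi ->
  0 < p < 1 -> 0 <= s < 2 * pi ->
  let x := r%:C * cis t in let v := half r t / half p^-1 s in
  S_kernel M.+1 x (p%:C * cis s) =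
  - (Dcst R M)%:C * (weight x * (Tcst M r)%:C) * (p^-1 * Tcst M p)%:C *
    (M%:R * (v + v^-1) ^ (M.+1%:Z - 2) * (v - v^-1)).
Proof.
move=> r0 ht hp hs x v; rewrite -kernel_sum_disk// -/x /S_kernel [odd M.+1]/=; case: ifPn => oM.
  rewrite (_ : M.+1 = (2 * M./2).+1); last by lia.
  rewrite S_odd_sum /kappa normc_polar; last by case/andP: hp => /ltW.
  by case/andP: hp => _ ->; rewrite addr0 (_ : (2 * M./2)%N = M)//; lia.
by rewrite S_even_sum// -[odd M]negbK.
Qed.

End closed_forms.

(** * Matching constants and branches of roots with the stated formulas *)

Section constants.
Variable R : realType.

(* Abstracting [2 ^+ M] first keeps [realCM] from splitting the power. *)
Lemma DcstC (M : nat) :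
  (Dcst R M)%:C = M.+1%:R / (4 * (2 ^+ M)%:C * (Num.sqrt pi)%:C).
Proof.
rewrite /Dcst (_ : 2 ^+ M.+2 = 4 * 2 ^+ M :> R); last by rewrite !exprS; ring.
by move: (2 ^+ M) (Num.sqrt pi) => t S; rewrite realCM realCV !realCM !realC_nat.
Qed.

Lemma const_cr (M : nat) :
  (2 ^+ M.+1 * Num.sqrt pi)%:C = 2 * (2 ^+ M)%:C * (Num.sqrt pi)%:C :> R[i].
Proof.
by rewrite exprS; move: (2 ^+ M) (Num.sqrt pi) => t S; rewrite !realCM !realC_nat.
Qed.

Lemma const_rc (M : nat) :
  (M.+1%:R * (M.+1%:R - 1) / (2 ^+ (M.+1 + 2) * Num.sqrt pi))%:C =
  M.+1%:R * M%:R / (8 * (2 ^+ M)%:C * (Num.sqrt pi)%:C) :> R[i].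
Proof.
rewrite (_ : M.+1%:R - 1 = M%:R :> R); last by rewrite -natr1; ring.
rewrite addn2 (_ : 2 ^+ M.+3 = 8 * 2 ^+ M :> R); last by rewrite !exprS; ring.
move: (2 ^+ M) (Num.sqrt pi) => t S.
by rewrite realCM realCV !realCM !realC_nat.
Qed.

Lemma const_cc (M : nat) (a b : R) :
  (M.+1%:R * (M.+1%:R - 1) / (2 ^+ (M.+1 + 1) * pi * a * b))%:C =
  M.+1%:R * M%:R / (4 * (2 ^+ M)%:C * (Num.sqrt pi)%:C ^+ 2 * a%:C * b%:C) :> R[i].
Proof.
rewrite (_ : M.+1%:R - 1 = M%:R :> R); last by rewrite -natr1; ring.
rewrite addn1 (_ : 2 ^+ M.+2 = 4 * 2 ^+ M :> R); last by rewrite !exprS; ring.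
rewrite -realCX sqr_sqrtr ?pi_ge0//.
move: (2 ^+ M) (pi : R) => t S.
by rewrite realCM realCV !realCM !realC_nat.
Qed.

Lemma sqrtc_negi (a : R) : 0 < a ->
  sqrtc (- 'i%C * a%:C) = (Num.sqrt (a / 2))%:C * (1 -i* 1).
Proof.
move=> a0.
have -> : - 'i%C * a%:C = 0 -i* a :> R[i].
  by apply/eqP; rewrite eq_complex /=; apply/andP; split; apply/eqP; ring.
rewrite /sqrtc oppr_eq0 gt_eqF// expr0n add0r sqrrN sqrtr_sqr gtr0_norm//.
rewrite addr0 subr0 sgrN gtr0_sg//.
by apply/eqP; rewrite eq_complex /=; apply/andP; split; apply/eqP; ring.
Qed.

(** Both radicands lie on the negative imaginary half-axis, so their principal roots differ by a
    positive real factor, without sign ambiguity. *)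
Lemma sqrtc_negi_sqrt_pi :
  sqrtc (- 'i%C / (Num.sqrt pi)%:C) =
  (Num.sqrt 2 * Num.sqrt (Num.sqrt pi)^-1)%:C * sqrtc (- 'i%C / 2) :> R[i].
Proof.
have s0 := sqrt_pi_gt0 R.
have -> : - 'i%C / 2 = - 'i%C * (2^-1)%:C :> R[i] by rewrite realCV realC_nat.
rewrite -realCV.
rewrite !sqrtc_negi ?invr_gt0// mulrA -realCM; congr (_%:C * _).
rewrite -!sqrtrM ?mulr_ge0 ?invr_ge0 ?sqrtr_ge0//.
by congr Num.sqrt; field; rewrite gt_eqF.
Qed.

Lemma half_div (r t p s d : R) : 0 < r -> 0 < p -> d = (t - s) / 2 ->
  half r t / half p s = (Num.sqrt (r / p))%:C * cis d.
Proof.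
move=> r0 p0 ->; rewrite /half invfM mulrACA -realCV -realCM -cisN -cisD.
rewrite sqrtrM ?ltW// sqrtrV ?ltW//.
by congr (_ * cis _); field.
Qed.

Lemma powR_half_inv (q : R) (d : R) : 0 < q ->
  cis (- d) / (q `^ (1 / 2))%:C = ((Num.sqrt q)%:C * cis d)^-1.
Proof. by move=> q0; rewrite div1r powR12_sqrt ?ltW// cisN invfM mulrC. Qed.

Lemma powR_half (q : R) (d : R) : 0 < q ->
  cis d / (q `^ (- (1 / 2)))%:C = (Num.sqrt q)%:C * cis d.
Proof.
by move=> q0; rewrite powRN div1r powR12_sqrt ?ltW// realCV invrK mulrC.
Qed.

Lemma Tcst_tail (M : nat) (r : R) : 0 < r < 1 ->
  Tcst M r = Num.sqrt (Num.sqrt pi)^-1 * Num.sqrt (tail M.+1 ((r^-1 - r) / 2)).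
Proof.
move=> /andP[r0 r1]; rewrite /Tcst ger0_norm ?sqrtrM ?invr_ge0 ?sqrtr_ge0//.
by rewrite subr_ge0 ltW// (lt_trans r1)// invf_gt1.
Qed.

Lemma sqrt2_Tcst1 (M : nat) :
  Num.sqrt 2 * Num.sqrt (Gamma ((M.+1%:R + 1) / 2) / Gamma (M.+1%:R / 2 + 1)) =
  2 * Tcst M 1 :> R.
Proof.
have p0 : pi != 0 :> R by rewrite gt_eqF// pi_gt0.
by apply: (mulfI p0); have := nuE R M; rewrite /nu => e; rewrite mulrA [pi * _]mulrC e; ring.
Qed.

Lemma Dcst_Tcst1 (M : nat) :
  2 * Dcst R M * Tcst M 1 ^+ 2 * 2 ^+ M =
  Gamma ((M.+1%:R + 1) / 2) / (2 * Num.sqrt pi * Gamma (M.+1%:R / 2)).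
Proof.
have s0 := sqrt_pi_gt0 R.
have n0 : 0 < M.+1%:R / 2 :> R by rewrite divr_gt0.
have G0 : 0 < Gamma (M.+1%:R / 2) :> R.
  by rewrite -natr1 Gamma_half_nat_gt0.
rewrite Tcst1_sqr GammaD1// /Dcst !exprS.
by field; rewrite !gt_eqF ?exprn_gt0 ?ltr0n.
Qed.

End constants.

Theorem proposition6p22 (R : realType) (N : nat) (hN : (0 < N)%N)
    (th1 th2 thw thz rw rz : R)
    (hth1 : 0 <= th1 < 2 * pi) (hth2 : 0 <= th2 < 2 * pi)
    (hthw : 0 <= thw < 2 * pi) (hthz : 0 <= thz < 2 * pi)
    (hrw : 0 < rw < 1) (hrz : 0 < rz < 1) :
  let e1 := cis th1 in
  let e2 := cis th2 in
  let w := rw%:C * cis thw in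
  let z := rz%:C * cis thz in
  let J (r : R) : R := Num.sqrt (tail N ((r^-1 - r) / 2)) in
  let g : R := Num.sqrt (Gamma ((N%:R + 1) / 2) / Gamma (N%:R / 2 + 1)) in
  let c : R[i] := sqrtc (- 'i%C / (Num.sqrt pi)%:C) in
  [/\ S_kernel N e1 e2 =
        (Gamma ((N%:R + 1) / 2) / (2 * Num.sqrt pi * Gamma (N%:R / 2))
         * cos ((th2 - th1) / 2) ^+ (N - 1))%:C,
      S_kernel N w e1 =
        c * (rw^-1)%:C * ('i%C * N%:R / (2 ^+ N * Num.sqrt pi)%:C)
        * g%:C * (J rw)%:C
        * (cis (- ((thw - th1) / 2)) / (rw `^ (1 / 2))%:C
           + cis ((thw - th1) / 2) / (rw `^ (- (1 / 2)))%:C) ^+ (N - 1),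
      S_kernel N e1 w =
        c * (rw^-1)%:C
        * (N%:R * (N%:R - 1) / (2 ^+ (N + 2) * Num.sqrt pi))%:C
        * (J rw)%:C * g%:C
        * (cis (- ((th1 - thw) / 2)) / (rw `^ (1 / 2))%:C
           + cis ((th1 - thw) / 2) / (rw `^ (- (1 / 2)))%:C) ^ (N%:Z - 2)
        * (cis (- ((th1 - thw) / 2)) / (rw `^ (1 / 2))%:C
           - cis ((th1 - thw) / 2) / (rw `^ (- (1 / 2)))%:C)
    & S_kernel N w z =
        (N%:R * (N%:R - 1) / (2 ^+ (N + 1) * pi * rw * rz))%:C
        * (J rw)%:C * (J rz)%:C
        * (cis ((thz - thw) / 2) / ((rw * rz) `^ (1 / 2))%:C
           + cis (- ((thz - thw) / 2)) / ((rw * rz) `^ (- (1 / 2)))%:C)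
            ^ (N%:Z - 2)
        * (cis ((thz - thw) / 2) / ((rw * rz) `^ (1 / 2))%:C
           - cis (- ((thz - thw) / 2)) / ((rw * rz) `^ (- (1 / 2)))%:C)].
Proof.
case: N hN => // M _ e1 e2 w z J g c.
have rw0 : 0 < rw by case/andP: hrw.
have rz0 : 0 < rz by case/andP: hrz.
have sp0 := sqrt_pi_gt0 R.
set q := Num.sqrt (Num.sqrt pi)^-1 : R.
set s0 := sqrtc (- 'i%C / 2) : R[i].
have q2 : q ^+ 2 = (Num.sqrt pi)^-1 by rewrite sqr_sqrtr// invr_ge0 sqrtr_ge0.
have gE : Num.sqrt 2 * g = 2 * Tcst M 1 by exact: sqrt2_Tcst1.
have JE r : 0 < r < 1 -> Tcst M r = q * J r by exact: Tcst_tail.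
(* The factor sqrt 2 relating [c] to [s0] completes [g] to 2 [Tcst M 1], and pi^(-1/4), here [q],
   completes [J] to [Tcst]. The two mixed entries reduce to this identity. *)
have cE (j : R) : c * g%:C * j%:C = 2 * s0 * (Tcst M 1)%:C * (q * j)%:C.
  rewrite /c sqrtc_negi_sqrt_pi -/q -/s0.
  transitivity (s0 * (Num.sqrt 2 * g)%:C * (q * j)%:C); first by rewrite !realCM; ring.
  by rewrite gE [(2 * _)%:C]realCM realC_nat; ring.
have s02 : s0 ^+ 2 = - 'i%C / 2 by exact: sqr_sqrtc.
have i2 := sqr_i R.
have e1E : e1 = 1%:C * cis th1 by rewrite mul1r.
have spC : (Num.sqrt pi)%:C != 0 :> R[i] by rewrite rC_neq0// gt_eqF.
have tC : (2 ^+ M)%:C != 0 :> R[i] by rewrite rC_neq0// expf_neq0// pnatr_eq0.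
have rwC : rw%:C != 0 :> R[i] by rewrite rC_neq0// gt_eqF.
have rzC : rz%:C != 0 :> R[i] by rewrite rC_neq0// gt_eqF.
have We1 : weight e1 = s0 by exact: weight_circle.
split.
- rewrite e1E S_kernel_circle// -e1E -/s0 We1 subSS subn0.
  rewrite (half_div ltr01 ltr01 (erefl ((th1 - th2) / 2))) [1 / 1]divr1 sqrtr1 mul1r -cisN.
  have -> : cis ((th1 - th2) / 2) + cis (- ((th1 - th2) / 2)) =
      (2 * cos ((th2 - th1) / 2))%:C.
    rewrite -[(th2 - th1) / 2]opprK cosN (_ : - ((th2 - th1) / 2) = (th1 - th2) / 2);
      last by field.
    rewrite {2}/cis cosN sinN /cis.
    by apply/eqP; rewrite eq_complex /=; apply/andP; split; apply/eqP; ring.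
  rewrite -Dcst_Tcst1 -realCX.
  set C := cos _; set D := Dcst R M; set T := Tcst M 1.
  transitivity (4 * 'i%C * s0 ^+ 2 * (D * T * T * (2 * C) ^+ M)%:C).
    rewrite (realCM _ ((2 * C) ^+ M)) (realCM (D * T) T).
    by move: (D * T)%:C T%:C ((2 * C) ^+ M)%:C => X Y Z; ring.
  (* The root in [acoef] and the one in [bcoef] multiply to -i/2, which makes this entry real. *)
  rewrite s02 (_ : 4 * 'i%C * (- 'i%C / 2) = - 2 * 'i%C ^+ 2 :> R[i]); last by field.
  rewrite i2 mulrN1 opprK -(realC_nat R 2) -realCM exprMn.
  by congr (_%:C); ring.
- rewrite /w S_kernel_circle// -/s0 weight_disk// (JE rw hrw) subSS subn0.
  rewrite (half_div rw0 ltr01 (erefl ((thw - th1) / 2))) [rw / 1]divr1.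
  rewrite (powR_half_inv _ rw0) (powR_half _ rw0).
  rewrite -/w [_ + _^-1]addrC.
  set P := (_ + _) ^+ M.
  transitivity ((c * g%:C * (J rw)%:C) * (rw^-1)%:C *
    ('i%C * M.+1%:R / (2 ^+ M.+1 * Num.sqrt pi)%:C) * P); last by ring.
  rewrite cE const_cr (realCM (Dcst R M)) DcstC (realCM q) realCV.
  move: (Num.sqrt pi)%:C (2 ^+ M)%:C (J rw)%:C q%:C (Tcst M 1)%:C spC tC rwC s0
    {s02 cE We1} => S t j Q T1 spC tC rwC s0.
  by field; rewrite spC tC rwC.
- rewrite e1E S_kernel_disk// -e1E We1 (JE rw hrw).
  have rwV : 0 < rw^-1 by rewrite invr_gt0.
  (* The reflected point has modulus 1 / rw, so the quotient has modulus sqrt rw. The stated bracket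
     is v^-1 - v, the opposite of the derivative factor, which absorbs the minus sign. *)
  rewrite (half_div ltr01 rwV (erefl ((th1 - thw) / 2))) [1 / rw^-1]div1r invrK.
  rewrite (powR_half_inv _ rw0) (powR_half _ rw0).
  set v := _ * cis _; rewrite [v^-1 + v]addrC.
  set P := (_ + _) ^ _.
  transitivity ((c * g%:C * (J rw)%:C) * (rw^-1)%:C *
    (M.+1%:R * (M.+1%:R - 1) / (2 ^+ (M.+1 + 2) * Num.sqrt pi))%:C *
      P * (v^-1 - v)); last by ring.
  rewrite cE const_rc DcstC (realCM rw^-1) (realCM q) realCV.
  move: (Num.sqrt pi)%:C (2 ^+ M)%:C (J rw)%:C q%:C (Tcst M 1)%:C spC tC rwC s0
    {s02 cE We1} => S t j Q T1 spC tC rwC s0.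
  by move: v^-1 => v'; field; rewrite spC tC rwC.
- rewrite /w S_kernel_disk// weight_disk// (JE rw hrw) (JE rz hrz).
  have rwz : 0 < rw * rz by rewrite mulr_gt0.
  have rzV : 0 < rz^-1 by rewrite invr_gt0.
  rewrite (half_div rw0 rzV (erefl ((thw - thz) / 2))) invrK.
  rewrite (_ : (thz - thw) / 2 = - ((thw - thz) / 2)); last by field.
  rewrite opprK (powR_half_inv _ rwz) (powR_half _ rwz).
  set v := _ * cis _; rewrite [v^-1 + v]addrC.
  set P := (_ + _) ^ _.
  (* The two factors pi^(-1/4) from the weights and the 1 / sqrt pi in [Dcst] combine to the 1 / pi
     of the statement. *)
  have qC : q%:C ^+ 2 = ((Num.sqrt pi)%:C)^-1 by rewrite -realCX q2 realCV.
  rewrite const_cc DcstC (realCM rz^-1) (realCM q) (realCM q) !realCV.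
  transitivity (- (M.+1%:R / (4 * (2 ^+ M)%:C * (Num.sqrt pi)%:C)) * (rw%:C)^-1 *
    (rz%:C)^-1 * q%:C ^+ 2 * (J rw)%:C * (J rz)%:C * (M%:R * P * (v - v^-1))).
    move: (Num.sqrt pi)%:C (2 ^+ M)%:C (J rw)%:C (J rz)%:C q%:C => S t j j' Q.
    by ring.
  rewrite qC.
  move: (Num.sqrt pi)%:C (2 ^+ M)%:C (J rw)%:C (J rz)%:C spC tC => S t j j' spC tC.
  by move: v^-1 => v'; field; rewrite spC tC rwC rzC.
Qed.
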